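(* Let $n\ge 3$ and let $h:\mathbb{B}^n\to(-1,1)$ be a hyperbolic harmonic function. Then for every $x\in\mathbb{B}^n$, $$|\nabla h(x)|\le (n-1)\,\frac{1-|h(x)|^2}{1-|x|^2}.$$ Therefore, $$d_{h_2}(h(x_1),h(x_2))\le (n-1)\,d_{h_n}(x_1,x_2)\qquad\text{for all } x_1,x_2\in\mathbb{B}^n.$$
   Context: $\mathbb{B}^n$ is the open unit ball of $\mathbb{R}^n$ and $|\cdot|$ the Euclidean norm. A function $u\in C^2(\mathbb{B}^n,\mathbb{R})$ is hyperbolic harmonic if $\Delta_h u=0$ on $\mathbb{B}^n$, where $$\Delta_h u(x)=(1-|x|^2)^2\Delta u(x)+2(n-2)(1-|x|^2)\sum_{i=1}^n x_i\frac{\partial u}{\partial x_i}(x)$$ and $\Delta$ is the Euclidean Laplacian. $d_{h_n}$ denotes the hyperbolic distance on $\mathbb{B}^n$, i.e. the distance induced by the Riemannian metric $\frac{2|dx|}{1-|x|^2}$; for $n=2$, $d_{h_2}$ is the Poincaré distance of the unit disc (with the same normalization), and $(-1,1)$ is regarded as the real diameter of the unit disc. *)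

(* Defs.v *)
From HB Require Import structures.
From mathcomp Require Import all_boot all_order all_algebra.
From mathcomp Require Import all_classical all_reals all_analysis.

Set Implicit Arguments.
Unset Strict Implicit.
Unset Printing Implicit Defensive.

Import Order.TTheory GRing.Theory Num.Theory.
Import numFieldNormedType.Exports.

Local Open Scope classical_set_scope.
Local Open Scope ring_scope.

(* The library norm `|x| on 'rV[R]_n is the sup norm; it is used below only
   through the topology and the notion of derivative, which are the Euclidean
   ones. *)
Definition enorm (R : realType) (n : nat) (x : 'rV[R]_n) : R :=
  Num.sqrt (\sum_(i < n) x ord0 i ^+ 2).

Definition unit_ball (R : realType) (n : nat) : set 'rV[R]_n :=
  [set x | enorm x < 1].

Arguments unit_ball : clear implicits.

(* Functions on an open set A are represented by total functions, of which only
   the values on A matter. *)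

Definition partial (R : realType) (n : nat) (i : 'I_n) (f : 'rV[R]_n -> R)
  : 'rV[R]_n -> R := fun x => 'D_(delta_mx ord0 i) f x.

Definition gradient (R : realType) (n : nat) (f : 'rV[R]_n -> R)
  (x : 'rV[R]_n) : 'rV[R]_n := \row_(i < n) partial i f x.

Definition laplacian (R : realType) (n : nat) (f : 'rV[R]_n -> R)
  (x : 'rV[R]_n) : R := \sum_(i < n) partial i (partial i f) x.

Definition C1_on (R : realType) (n : nat) (A : set 'rV[R]_n)
  (f : 'rV[R]_n -> R) : Prop :=
  forall x, A x ->
    {for x, continuous f} /\
    forall i : 'I_n,
      derivable f x (delta_mx ord0 i) /\ {for x, continuous (partial i f)}.

Definition C2_on (R : realType) (n : nat) (A : set 'rV[R]_n)
  (f : 'rV[R]_n -> R) : Prop :=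
  C1_on A f /\ forall i : 'I_n, C1_on A (partial i f).

Definition hyp_laplacian (R : realType) (n : nat) (u : 'rV[R]_n -> R)
  (x : 'rV[R]_n) : R :=
  (1 - enorm x ^+ 2) ^+ 2 * laplacian u x
  + 2 * (n%:R - 2) * (1 - enorm x ^+ 2)
    * \sum_(i < n) x ord0 i * partial i u x.

Definition hyp_harmonic (R : realType) (n : nat) (u : 'rV[R]_n -> R) : Prop :=
  C2_on (unit_ball R n) u /\
  forall x, unit_ball R n x -> hyp_laplacian u x = 0.

(* C^1 up to the endpoints of [a, b]: the derivative, taken in the interior,
   extends continuously to the closed interval. *)
Definition C1_segment (R : realType) (n : nat) (a b : R) (g : R -> 'rV[R]_n)
  : Prop :=
  {within `[a, b], continuous g} /\
  exists dg : R -> 'rV[R]_n,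
    {within `[a, b], continuous dg} /\
    forall t, t \in `]a, b[ -> is_derive t 1 g (dg t).

Definition piecewise_C1 (R : realType) (n : nat) (a b : R)
  (g : R -> 'rV[R]_n) : Prop :=
  exists2 s : seq R, itv_partition a b s &
    forall i, (i < size s)%N -> C1_segment (nth b (a :: s) i) (nth b s i) g.

Definition curve_in_ball (R : realType) (n : nat) (x y : 'rV[R]_n)
  (g : R -> 'rV[R]_n) : Prop :=
  [/\ piecewise_C1 0 1 g, g 0 = x, g 1 = y
    & forall t, t \in `[0, 1] -> unit_ball R n (g t)].

(* The finitely many break points, where derive1 g may be meaningless, form a null
   set. *)
Definition hyp_length (R : realType) (n : nat) (g : R -> 'rV[R]_n) : \bar R :=
  (\int[@lebesgue_measure R]_(t in `[0%R, 1%R])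
    (2 * enorm (derive1 g t) / (1 - enorm (g t) ^+ 2))%:E)%E.

Definition hyp_dist (R : realType) (n : nat) (x y : 'rV[R]_n) : \bar R :=
  ereal_inf [set hyp_length g | g in curve_in_ball x y].

Definition real_diameter (R : realType) (t : R) : 'rV[R]_2 :=
  t *: delta_mx ord0 ord0.

(* Main.v *)
Require Import Defs.
From HB Require Import structures.
From mathcomp Require Import all_boot all_order all_algebra.
From mathcomp Require Import all_classical all_reals all_analysis.
From mathcomp Require Import measurable_realfun.
From mathcomp Require Import ring lra.

Set Implicit Arguments.
Unset Strict Implicit.
Unset Printing Implicit Defensive.

Import Order.TTheory GRing.Theory Num.Theory.
Import numFieldNormedType.Exports.
Local Open Scope classical_set_scope.
Local Open Scope ring_scope.

(** Let [w = artanh \o h], [K = (n - 1) / 2] and let [d] be the hyperbolic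
    distance of the ball. Both claims follow from the Lipschitz estimate
    [w x - w y <= K * d x y] ([artanh_lipschitz]), which is proved by a maximum
    principle for a function of two points. It differentiates [h] only twice,
    whereas the Bochner formula for [|grad w|^2] would need a third derivative.

    Since [h] is hyperbolic harmonic, [w] satisfies, in the hyperbolic metric of
    curvature [-1], [Laplacian w = 2 tanh(w) |grad w|^2]. Replacing [h] by
    [lam * h] with [lam < 1] makes [w] bounded. Suppose that
    [w x - w y - K * d x y] is positive somewhere; subtracting a small multiple
    of the barrier [- ln (1 - |x|^2)], whose hyperbolic gradient and Laplacian are
    bounded, makes the maximum over pairs of points attained
    ([two_point_attains_max]), and at a pair with [x != y]. There the first
    derivatives determine [grad w] at [x] and at [y]. For the second
    derivatives, [x] moves with speed [a] along the vectors of an orthonormal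
    frame while [y] moves with speed [b] along the frame reflected in the
    hyperplane orthogonal to [x - y]; this reflection is parallel transport
    along the geodesic from [x] to [y], up to the sign of the tangent
    direction. Summing over the frame produces both Laplacians and the second
    variation of [d], and yields ([two_point_inequality]), up to a multiple of
    the barrier coefficient, for all [a] and [b],
      [a^2 (cosh d - h x sinh d) + b^2 (cosh d + h y sinh d) >= 2 a b].
    A suitable choice of [a] and [b] turns this into
    [tanh (w x - w y) <= tanh d], against [w x - w y > K * d >= d]
    ([two_point_gap]); this is where [3 <= n], that is [1 <= K], enters.

    Letting [y] tend to [x], and then [lam] tend to [1], gives the gradient
    estimate ([gradient_estimate]). By the chain rule the map [h] multiplies
    hyperbolic speeds by at most [n - 1], hence also lengths of curves
    ([hyp_length_image_le]) and distances ([hyp_dist_image_le]). *)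

(** * Second-order jets of functions of one real variable *)

(** First and second derivative at [0]. The second one is asked for at [0]
    only, which suffices for the chain rule and for the test at a maximum. *)
Definition jet2 {R : realType} (f : R -> R) (a b : R) : Prop :=
  exists df : R -> R,
    [/\ \forall s \near 0, is_derive (s : R) 1 f (df s), df 0 = a
      & is_derive (0:R) 1 df b].

Lemma is_derive1_continuous {R : realType} (f : R -> R) (x a : R) :
  is_derive (x:R) 1 f a -> {for x, continuous f}.
Proof.
by move=> [df _]; apply/differentiable_continuous/derivable1_diffP.
Qed.

Lemma jet2_is_derive {R : realType} (f : R -> R) (a b : R) :
  jet2 f a b -> is_derive (0:R) 1 f a.
Proof. by case=> df [/nbhs_singleton + <- _]. Qed.

Lemma jet2_continuous {R : realType} (f : R -> R) (a b : R) :
  jet2 f a b -> {for 0, continuous f}.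
Proof. by move/jet2_is_derive/is_derive1_continuous. Qed.

Lemma jet2_near_eq {R : realType} (f g : R -> R) (a b : R) :
  (\forall s \near 0, f s = g s) -> jet2 f a b -> jet2 g a b.
Proof.
move=> fg [df [fdf df0 ddf]]; exists df; split=> //.
have := near_join fg; apply: filterS2 fdf => s fs fgs.
exact: near_eq_is_derive fgs fs.
Qed.

Lemma jet2D {R : realType} (f g : R -> R) (a b c d : R) :
  jet2 f a b -> jet2 g c d -> jet2 (fun s => f s + g s) (a + c) (b + d).
Proof.
move=> [df [fdf <- ddf]] [dg [gdg <- ddg]].
exists (fun s => df s + dg s); split=> //.
- by apply: filterS2 fdf gdg => s fs gs; exact: is_deriveD.
- exact: is_deriveD.
Qed.

Lemma jet2Z {R : realType} (f : R -> R) (k a b : R) :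
  jet2 f a b -> jet2 (fun s => k * f s) (k * a) (k * b).
Proof.
move=> [df [fdf <- ddf]].
exists (fun s => k * df s); split=> //.
- by apply: filterS fdf => s fs; exact: is_deriveZ.
- exact: is_deriveZ.
Qed.

Lemma jet2B {R : realType} (f g : R -> R) (a b c d : R) :
  jet2 f a b -> jet2 g c d -> jet2 (fun s => f s - g s) (a - c) (b - d).
Proof.
move=> jf /(jet2Z (-1)); rewrite !mulN1r => jg.
by have := jet2D jf jg; apply: jet2_near_eq; near=> s; rewrite mulN1r.
Unshelve. all: by end_near. Qed.

Lemma jet2_quadratic {R : realType} (c0 c1 c2 : R) :
  jet2 (fun s => c0 + (c1 * s + c2 * s ^+ 2)) c1 (2 * c2).
Proof.
have dq (k0 k1 k2 s : R) :
    is_derive (s:R) 1 (fun s => k0 + (k1 * s + k2 * s ^+ 2)) (k1 + 2 * k2 * s).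
  have di := is_derive_id s (1 : R).
  have dZ1 := is_deriveZ k1 di.
  have dZ2 := is_deriveZ k2 (is_deriveX 2 di).
  have dD := is_deriveD (is_derive_cst k0 s 1) (is_deriveD dZ1 dZ2).
  by apply: (is_derive_eq dD); rewrite /GRing.scale/=; ring.
exists (fun s => c1 + 2 * c2 * s); split; first by near do exact: dq.
- by rewrite mulr0 addr0.
- have := dq c1 (2 * c2) 0 0; rewrite !mulr0 addr0.
  by under eq_fun do rewrite mul0r addr0.
Unshelve. all: by end_near. Qed.

(** Faa di Bruno's formula of order two. *)
Lemma jet2_comp {R : realType} (F dF : R -> R) (f : R -> R) (ddF a b : R) :
  (\forall t \near f 0, is_derive (t : R) 1 F (dF t)) ->
  is_derive (f 0) 1 dF ddF -> jet2 f a b ->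
  jet2 (fun s => F (f s)) (dF (f 0) * a) (ddF * a ^+ 2 + dF (f 0) * b).
Proof.
move=> FdF dFddF jf; have fc := jet2_continuous jf.
case: jf => df [fdf df0 ddf].
have f'0 := nbhs_singleton fdf.
exists (fun s => dF (f s) * df s); split.
- have := fc _ FdF; apply: filterS2 fdf => s fs Fs.
  exact: is_derive1_comp.
- by rewrite df0.
- have d1 : is_derive (0:R) 1 (dF \o f) (ddF * a).
    by rewrite -df0; apply: is_derive1_comp.
  apply: is_derive_eq; rewrite /GRing.scale/= df0; ring.
Unshelve. all: by end_near. Qed.

Lemma jet2_ln {R : realType} (f : R -> R) (a b : R) :
  0 < f 0 -> jet2 f a b ->
  jet2 (fun s => ln (f s)) (a / f 0) (b / f 0 - (a / f 0) ^+ 2).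
Proof.
move=> f0 jf.
have n0 : f 0 != 0 by rewrite gt_eqF.
have := @jet2_comp _ (@ln R) (fun t => t^-1) f (- (f 0) ^- 2) a b _ _ jf.
rewrite [_ * a]mulrC (_ : _ * a ^+ 2 + _ = b / f 0 - (a / f 0) ^+ 2); last first.
  by field.
apply.
- near=> t; apply: is_derive1_ln; near: t; exact: lt_nbhsr.
- have dV := is_deriveV (f := id) n0 (is_derive_id _ _).
  by apply: (is_derive_eq (dV 1)); rewrite /GRing.scale/= mulr1.
Unshelve. all: by end_near. Qed.

(** Where [f' = 0 < f''] the derivative is positive just to the right, so that
    [f] increases there by the mean value theorem. *)
Lemma jet2_max {R : realType} (f : R -> R) (a b : R) :
  jet2 f a b -> (\forall s \near 0, f s <= f 0) -> a = 0 /\ b <= 0.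
Proof.
move=> [df [fdf df0 ddf]] fmax.
have a0 : a = 0.
  have [/= e e0 He] := filterI fdf fmax.
  have inb t : t \in `]-e, e[ -> is_derive (t : R) 1 f (df t) /\ f t <= f 0.
    move=> te; apply: He; rewrite /= sub0r normrN ltr_norml.
    by move: te; rewrite in_itv.
  have z_in : 0 \in `]-e, e[ by rewrite in_itv/= oppr_lt0 e0.
  have d0 : is_derive (0 : R) 1 f 0.
    apply: (derive1_at_max (a := - e) (b := e)) => //.
    - by rewrite -subr_ge0 opprK addr_ge0 ?ltW.
    - by move=> t /inb[[]].
    - by move=> t /inb[].
  have [[_ d0E] _] := inb _ z_in.
  by rewrite -df0 -d0E; exact: derive_val.
split=> //; rewrite leNgt; apply/negP => b0.
have dfpos : \forall s \near 0^'+, 0 < df s.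
  case: ddf => ddf ddfE; have := ddf => /cvg_ex[l lb].
  have lE : l = b by rewrite -ddfE; apply/esym; apply: cvg_lim lb.
  have := lb [set t | 0 < t]; rewrite lE => /(_ (lt_nbhsr b0)).
  rewrite near_simpl /= !nearE => -[e /= e0 He].
  exists e => //= s se s0; have := He s se; rewrite /= addr0 df0 a0 subr0.
  by rewrite [_%:A]mulr1 => /(_ (lt0r_neq0 s0)); rewrite pmulr_rgt0 ?invr_gt0.
have [e1 /= e10 He1] := filterI fdf fmax.
have [e2 /= e20 He2] := dfpos.
pose e := Num.min e1 e2 / 2.
have m0 : 0 < Num.min e1 e2 by rewrite lt_min e10.
have e0 : 0 < e by rewrite divr_gt0.
have em : e < Num.min e1 e2 by rewrite ltr_pdivrMr// ltr_pMr// ltr1n.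
have near1 t : 0 <= t <= e -> is_derive (t : R) 1 f (df t) /\ f t <= f 0.
  move=> /andP[t0 te]; apply: He1; rewrite /= sub0r normrN ger0_norm//.
  by rewrite (le_lt_trans te)// (lt_le_trans em)// ge_min lexx.
have [||c] := @MVT R f df 0 e e0.
- by move=> t; rewrite in_itv/= => /andP[t0 te]; apply: (near1 _ _).1; rewrite !ltW.
- apply: derivable_within_continuous => t; rewrite in_itv/= => te.
  by case: (near1 _ te) => -[].
rewrite in_itv/= => /andP[c0 ce] E.
have : 0 < df c.
  apply: He2 => //=; rewrite sub0r normrN gtr0_norm//.
  by rewrite (lt_trans ce)// (lt_le_trans em)// ge_min lexx orbT.
have : f e <= f 0 by apply: (near1 _ _).2; rewrite lexx ltW.
rewrite -subr_le0 E subr0 => /[swap] dc.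
by rewrite pmulr_rle0// leNgt e0.
Qed.

(** * Functions with continuous partial derivatives *)

Lemma is_derive_line {R : realType} {n : nat} (f : 'rV[R]_n -> R)
    (z v : 'rV[R]_n) (s d : R) :
  is_derive (z + s *: v) v f d -> is_derive s 1 (fun t => f (z + t *: v)) d.
Proof.
have E : (fun h : R => h^-1 *: (((fun t => f (z + t *: v)) \o shift s) (h *: 1)
            - f (z + s *: v))) =
         (fun h : R => h^-1 *: ((f \o shift (z + s *: v)) (h *: v)
            - f (z + s *: v))).
  apply/funext => h /=; congr (_ *: (f _ - _)).
  by rewrite [h%:A]mulr1 scalerDl addrCA.
by move=> [dfzs fE]; split; rewrite /derivable /derive E.
Qed.

(** Rescaling to [[0, 1]] makes the statement uniform in the sign of [t]. *)
Lemma mean_value {R : realType} (g dg : R -> R) (t : R) :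
  (forall c : R, 0 <= c <= 1 -> is_derive (c * t) 1 g (dg (c * t))) ->
  exists2 c : R, 0 <= c <= 1 & g t - g 0 = t * dg (c * t).
Proof.
move=> gdg.
have dk (c : R) : 0 <= c <= 1 -> is_derive c 1 (g \o *%R^~ t) (dg (c * t) * t).
  move=> /gdg gc; apply: is_derive1_comp.
  have dZ := is_deriveZ t (is_derive_id c (1 : R)).
  have -> : *%R^~ t = t \*: id by apply/funext => u; rewrite /= mulrC.
  by apply: (is_derive_eq dZ); rewrite /GRing.scale/= mulr1.
have [||c] := @MVT_segment R (g \o *%R^~ t) (fun c => dg (c * t) * t) 0 1 ler01.
- by move=> c; rewrite in_itv/= => /andP[c0 c1]; apply: dk; rewrite !ltW.
- by apply: derivable_within_continuous => c; rewrite in_itv/= => /dk[].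
rewrite in_itv/= => c01; rewrite mul1r mul0r subr0 mulr1 => E.
by exists c => //; rewrite E mulrC.
Qed.

Lemma coord_le_norm {R : realType} {n : nat} (v : 'rV[R]_n) (i : 'I_n) :
  `|v ord0 i| <= `|v|.
Proof.
by rewrite [leRHS]/Num.norm/= mx_normrE; apply: (le_bigmax _ _ (ord0, i)).
Qed.

Lemma norm_le_coord {R : realType} {n : nat} (v : 'rV[R]_n) (r : R) :
  0 <= r -> (forall i, `|v ord0 i| <= r) -> `|v| <= r.
Proof.
move=> r0 vr; rewrite [leLHS]/Num.norm/= mx_normrE.
by apply: bigmax_le => // -[i j] _; rewrite /= ord1.
Qed.

(** The increment of [f] is split along the edges of a staircase from [x] to
    [x + h], and the mean value theorem is applied on each edge; as the sup norm
    is used, the staircase stays within distance [`|h|] of [x]. *)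
Lemma C1_differential {R : realType} {n : nat} (A : set 'rV[R]_n)
    (f : 'rV[R]_n -> R) (x : 'rV[R]_n) : open A -> C1_on A f -> A x ->
  differentiable f x /\
  forall v, 'd f x v = \sum_(i < n) v ord0 i * partial i f x.
Proof.
move=> oA Cf Ax.
pose d (v : 'rV[R]_n) := \sum_(i < n) v ord0 i * partial i f x.
have lin_d : linear d.
  move=> k u v; rewrite /d scaler_sumr -big_split/=; apply: eq_bigr => i _.
  by rewrite !mxE mulrDl [_ *: _]mulrA.
pose dM := GRing.isLinear.Build _ _ _ _ _ lin_d.
pose L : {linear 'rV[R]_n -> R} := HB.pack d dM.
have cL : continuous L.
  have -> : (L : _ -> _) = \sum_(i < n) (fun v : 'rV[R]_n => v ord0 i * partial i f x).
    by apply/funext => v; rewrite fct_sumE.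
  elim/big_ind : _ => [y|g1 g2 c1 c2 y|i _ y].
  - exact: cst_continuous.
  - by apply: continuousD; [exact: c1|exact: c2].
  - by apply: (@continuousM R _ (fun v : 'rV[R]_n => v ord0 i) (cst _));
      [exact: coord_continuous|exact: cst_continuous].
suff fL : f \o shift x = cst (f x) + (L : 'rV[R]_n -> R) +o_ (0 : 'rV[R]_n) id.
  have dE := diff_unique cL fL; split; last by move=> v; rewrite dE.
  by apply/diff_locallyP; rewrite dE.
apply/eqaddoP => _/posnumP[e].
have [n0|n_gt0] := posnP n.
  have noI (i : 'I_n) : false.
    by move: (leq_ltn_trans (leq0n i) (ltn_ord i)); rewrite n0.
  near=> h; have -> : h = 0 by apply/rowP => i; have := noI i.
  rewrite !fctE /= normr0 mulr0 add0r /d big1 ?addr0 ?subrr ?normr0// => i.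
  by have := noI i.
have nA : \forall y \near x, A y by exact: open_nbhs_nbhs.
have np : \forall y \near x, forall i, `|partial i f x - partial i f y| <= e%:num / n%:R.
  apply: (@filter_forall _ _
    (fun i y => `|partial i f x - partial i f y| <= e%:num / n%:R) (nbhs x)) => i.
  have [_ /(_ i)[_ ci]] := Cf x Ax.
  by move/cvgrPdist_le : ci; apply; rewrite divr_gt0// ltr0n.
have [r /= r0 Hr] := (nbhs_ballP x _).1 (filterI nA np).
near=> h.
have hr : `|h| < r.
  near: h; have : nbhs (0 : 'rV[R]_n) (ball 0 r) by exact: nbhsx_ballx.
  by apply: filterS => h; rewrite -ball_normE /ball_/= sub0r normrN.
(* The vertices of the staircase are [x + tr k]. *)
pose tr (k : nat) : 'rV[R]_n := \row_(i < n) if (i < k)%N then h ord0 i else 0.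
have tr0 : tr 0%N = 0 by apply/rowP => i; rewrite !mxE.
have trn : tr n = h by apply/rowP => i; rewrite !mxE ltn_ord.
have trS (i : 'I_n) : tr i.+1 = tr i + h ord0 i *: delta_mx ord0 i.
  apply/rowP => j; rewrite !mxE/= -val_eqE/= ltnS.
  have [ij|ij|/val_inj ->] := ltngtP j i; by rewrite ?eqxx/= ?mulr1 ?mulr0 ?addr0 ?add0r.
have close (i : 'I_n) (c : R) : 0 <= c <= 1 ->
    `|tr i + (c * h ord0 i) *: delta_mx ord0 i| < r.
  move=> /andP[c0 c1]; apply: le_lt_trans hr; apply: norm_le_coord => // j.
  rewrite !mxE/= -val_eqE/=; have [ij|ij|_] := ltngtP j i.
  - by rewrite mulr0 addr0 coord_le_norm.
  - by rewrite mulr0 addr0 normr0.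
  - rewrite add0r mulr1 normrM ger0_norm//.
    by rewrite (le_trans _ (coord_le_norm h i))// ler_piMl.
have step (i : 'I_n) : `|f (x + tr i.+1) - f (x + tr i) - h ord0 i * partial i f x|
    <= `|h| * (e%:num / n%:R).
  pose g (t : R) := f (x + tr i + t *: delta_mx ord0 i).
  pose dg (t : R) := partial i f (x + tr i + t *: delta_mx ord0 i).
  have inr (c : R) : 0 <= c <= 1 -> ball x r (x + tr i + (c * h ord0 i) *: delta_mx ord0 i).
    move=> /close; rewrite -addrA -ball_normE /ball_/=.
    by rewrite opprD addrA subrr sub0r normrN.
  have [c c01 gE] : exists2 c : R, 0 <= c <= 1 &
      g (h ord0 i) - g 0 = h ord0 i * dg (c * h ord0 i).
    apply: mean_value => c /inr /Hr[Ac _]; apply: is_derive_line.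
    by have [_ /(_ i)[/derivableP + _]] := Cf _ Ac; rewrite /dg.
  have -> : f (x + tr i.+1) = g (h ord0 i) by rewrite /g trS addrA.
  have -> : f (x + tr i) = g 0 by rewrite /g scale0r addr0.
  rewrite gE -mulrBr normrM ler_pM// ?coord_le_norm//.
  by rewrite distrC; have [_] := Hr _ (inr _ c01); apply.
rewrite !fctE /= [h + x]addrC /d opprD addrA.
have -> : f (x + h) - f x = \sum_(i < n) (f (x + tr i.+1) - f (x + tr i)).
  rewrite -(big_mkord xpredT (fun i => f (x + tr i.+1) - f (x + tr i))).
  by rewrite (telescope_sumr (fun i => f (x + tr i)))// trn tr0 addr0.
rewrite -sumrB (le_trans (ler_norm_sum _ _ _))//.
rewrite (le_trans (ler_sum _ (fun i _ => step i)))//.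
rewrite sumr_const card_ord -[_ *+ n]mulr_natr -mulrA divfK ?pnatr_eq0 -?lt0n//.
by rewrite mulrC.
Unshelve. all: by end_near. Qed.

Lemma C1_is_derive {R : realType} {n : nat} (A : set 'rV[R]_n)
    (f : 'rV[R]_n -> R) (x v : 'rV[R]_n) : open A -> C1_on A f -> A x ->
  is_derive x v f (\sum_(i < n) v ord0 i * partial i f x).
Proof.
move=> oA Cf Ax; have [df dfE] := C1_differential oA Cf Ax.
split; first exact: diff_derivable.
by rewrite deriveE.
Qed.

Lemma C1_is_derive_comp {R : realType} {n : nat} (A : set 'rV[R]_n)
    (f : 'rV[R]_n -> R) (g : R -> 'rV[R]_n) (t : R) (dg : 'rV[R]_n) :
  open A -> C1_on A f -> A (g t) -> is_derive t 1 g dg ->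
  is_derive t 1 (f \o g) (\sum_(i < n) dg ord0 i * partial i f (g t)).
Proof.
move=> oA Cf Ag [/derivable1_diffP gt gE].
have [fgt fE] := C1_differential oA Cf Ag.
split; first exact/derivable1_diffP/differentiable_comp.
rewrite deriveE; last exact: differentiable_comp.
by rewrite diff_comp//= -(deriveE _ gt) gE fE.
Qed.

Lemma line_continuous {R : realType} {n : nat} (x v : 'rV[R]_n) :
  continuous (fun s : R => x + s *: v).
Proof.
by move=> s; apply: cvgD; [exact: cvg_cst|exact: scalel_continuous].
Qed.

Lemma near_line {R : realType} {n : nat} (A : set 'rV[R]_n) (x v : 'rV[R]_n) :
  open A -> A x -> \forall s \near (0 : R), A (x + s *: v).
Proof.
move=> oA Ax; have := @line_continuous _ _ x v (0 : R).
rewrite /continuous_at scale0r addr0 => /(_ A); apply.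
exact: open_nbhs_nbhs.
Qed.

Lemma C2_jet2 {R : realType} {n : nat} (A : set 'rV[R]_n)
    (f : 'rV[R]_n -> R) (x v : 'rV[R]_n) : open A -> C2_on A f -> A x ->
  jet2 (fun s => f (x + s *: v)) (\sum_(i < n) v ord0 i * partial i f x)
    (\sum_(i < n) v ord0 i *
       \sum_(j < n) v ord0 j * partial j (partial i f) x).
Proof.
move=> oA [Cf Cdf] Ax.
exists (fun s => \sum_(i < n) v ord0 i * partial i f (x + s *: v)); split.
- near=> s; apply: is_derive_line; apply: (C1_is_derive _ oA Cf).
  by near: s; exact: near_line.
- by rewrite scale0r addr0.
- have di (i : 'I_n) : is_derive (0 : R) 1
      (fun s => v ord0 i * partial i f (x + s *: v))
      (v ord0 i * \sum_(j < n) v ord0 j * partial j (partial i f) x).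
    apply: is_deriveZ; apply: is_derive_line; rewrite scale0r addr0.
    exact: (C1_is_derive _ oA (Cdf i)).
  have := is_derive_sum di.
  rewrite (_ : \sum_(i < n) _ = (fun s => \sum_(i < n) v ord0 i * partial i f (x + s *: v)))//.
  by apply/funext => s; rewrite fct_sumE.
Unshelve. all: by end_near. Qed.

(** * Euclidean geometry of row vectors *)

Definition dot {R : realType} {n : nat} (x y : 'rV[R]_n) : R :=
  \sum_(i < n) x ord0 i * y ord0 i.

Section Dot.
Context {R : realType} {n : nat}.
Implicit Types x y z : 'rV[R]_n.

Lemma dotC x y : dot x y = dot y x.
Proof. by apply: eq_bigr => i _; rewrite mulrC. Qed.

Lemma dotDl x y z : dot (x + y) z = dot x z + dot y z.
Proof. by rewrite -big_split; apply: eq_bigr => i _; rewrite mxE mulrDl. Qed.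

Lemma dotZl (k : R) x y : dot (k *: x) y = k * dot x y.
Proof. by rewrite mulr_sumr; apply: eq_bigr => i _; rewrite mxE mulrA. Qed.

Lemma dotDr x y z : dot x (y + z) = dot x y + dot x z.
Proof. by rewrite dotC dotDl !(dotC x). Qed.

Lemma dotZr (k : R) x y : dot x (k *: y) = k * dot x y.
Proof. by rewrite dotC dotZl dotC. Qed.

Lemma dotNl x y : dot (- x) y = - dot x y.
Proof. by rewrite -scaleN1r dotZl mulN1r. Qed.

Lemma dotNr x y : dot x (- y) = - dot x y.
Proof. by rewrite dotC dotNl dotC. Qed.

Definition dotE := (dotDl, dotDr, dotNl, dotNr, dotZl, dotZr).

Lemma dot_delta x (i : 'I_n) : dot x (delta_mx ord0 i) = x ord0 i.
Proof.
rewrite /dot (bigD1 i)//= big1 ?addr0 ?mxE ?eqxx ?mulr1// => j ji.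
by rewrite mxE eqxx (negbTE ji) mulr0.
Qed.

Lemma dot_ge0 x : 0 <= dot x x.
Proof. by apply: sumr_ge0 => i _; rewrite -expr2 sqr_ge0. Qed.

Lemma dot_eq0 x : (dot x x == 0) = (x == 0).
Proof.
apply/eqP/eqP => [|->]; last by rewrite /dot big1// => i _; rewrite mxE mul0r.
move=> /psumr_eq0P xx0; apply/rowP => i; rewrite mxE.
have /eqP := xx0 (fun i _ => ltac:(by rewrite -expr2 sqr_ge0)) i isT.
by rewrite mulf_eq0 orbb => /eqP.
Qed.

Lemma dot_gt0 x : (0 < dot x x) = (x != 0).
Proof. by rewrite lt_def dot_eq0 dot_ge0 andbT. Qed.

Lemma enormE x : enorm x = Num.sqrt (dot x x).
Proof. by congr Num.sqrt; apply: eq_bigr => i _; rewrite expr2. Qed.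

Lemma enorm_ge0 x : 0 <= enorm x.
Proof. exact: sqrtr_ge0. Qed.

Lemma enorm_sqr x : enorm x ^+ 2 = dot x x.
Proof. by rewrite enormE sqr_sqrtr ?dot_ge0. Qed.

Lemma unit_ballE x : unit_ball R n x <-> 0 < 1 - dot x x.
Proof.
rewrite subr_gt0 -enorm_sqr /unit_ball/=; split=> [xl|].
  by rewrite expr_lt1// enorm_ge0.
by rewrite expr_lt1// enorm_ge0.
Qed.

Lemma cauchy_schwarz x y : `|dot x y| <= enorm x * enorm y.
Proof.
rewrite -ler_sqr ?nnegrE ?mulr_ge0 ?enorm_ge0// exprMn !enorm_sqr.
rewrite real_normK ?num_real//.
have [->|y0] := eqVneq y 0.
  by rewrite -(scale0r (0 : 'rV[R]_n)) !dotE !mul0r mulr0 expr0n.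
have yy : 0 < dot y y by rewrite dot_gt0.
have := dot_ge0 (dot y y *: x - dot x y *: y).
rewrite !dotE (dotC y x) -(pmulr_rge0 _ yy) => H; rewrite -subr_ge0.
rewrite -(pmulr_rge0 _ yy) -(pmulr_rge0 _ yy).
by apply: (le_trans H); rewrite le_eqVlt; apply/orP; left; apply/eqP; ring.
Qed.

End Dot.

Lemma sum_continuous {R : realType} {n : nat} (T : topologicalType)
    (f : 'I_n -> T -> R) (t : T) : (forall i, {for t, continuous (f i)}) ->
  {for t, continuous (fun s => \sum_(i < n) f i s)}.
Proof.
move=> cf; have -> : (fun s => \sum_(i < n) f i s) = \sum_(i < n) f i.
  by apply/funext => s; rewrite fct_sumE.
elim/big_ind : _ => [|g1 g2 c1 c2|i _]; last exact: cf.
- exact: cst_continuous.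
- exact: continuousD.
Qed.

Lemma coord_comp_continuous {R : realType} {n : nat} (T : topologicalType)
    (f : T -> 'rV[R]_n) (t : T) (i : 'I_n) : {for t, continuous f} ->
  {for t, continuous (fun s => f s ord0 i)}.
Proof.
move=> cf; apply: (@continuous_comp _ _ _ f (fun M : 'rV[R]_n => M ord0 i)) => //.
exact: coord_continuous.
Qed.

Lemma dot_continuous {R : realType} {n : nat} (T : topologicalType)
    (f g : T -> 'rV[R]_n) (t : T) :
  {for t, continuous f} -> {for t, continuous g} ->
  {for t, continuous (fun s => dot (f s) (g s))}.
Proof.
move=> cf cg; apply: sum_continuous => i.
by apply: (@continuousM R _ (fun s => f s ord0 i) (fun s => g s ord0 i));
  exact: coord_comp_continuous.
Qed.

Lemma open_unit_ball {R : realType} {n : nat} : open (unit_ball R n).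
Proof.
have -> : unit_ball R n = [set x | 0 < (fun x => 1 - dot x x) x].
  by apply/seteqP; split=> x /unit_ballE.
apply: (@open_comp _ _ (fun x : 'rV[R]_n => 1 - dot x x) [set t | 0 < t]).
  move=> x _; apply: (@continuousB R R^o _ (cst 1) (fun x => dot x x)).
    exact: cst_continuous.
  by apply: dot_continuous.
exact: open_gt.
Qed.

(** * The hyperbolic distance and the two-point function *)

Definition artanh {R : realType} (t : R) : R := (ln (1 + t) - ln (1 - t)) / 2.

Lemma jet2_artanh {R : realType} (f : R -> R) (a b : R) :
  -1 < f 0 < 1 -> jet2 f a b ->
  jet2 (fun s => artanh (f s)) (a / (1 - f 0 ^+ 2))
    (2 * f 0 * (a / (1 - f 0 ^+ 2)) ^+ 2 + b / (1 - f 0 ^+ 2)).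
Proof.
move=> /andP[fN1 f1] jf.
have jp := jet2D (jet2_quadratic 1 0 0) jf.
have jm := jet2B (jet2_quadratic 1 0 0) jf.
have p0 : 0 < 1 + f 0 by rewrite -ltrBlDl sub0r.
have m0 : 0 < 1 - f 0 by rewrite subr_gt0.
have np : 1 + f 0 != 0 by rewrite gt_eqF.
have nm : 1 - f 0 != 0 by rewrite gt_eqF.
have n2 : 1 - f 0 ^+ 2 != 0.
  by rewrite (_ : 1 - f 0 ^+ 2 = (1 + f 0) * (1 - f 0)) ?mulf_neq0//; ring.
have {}jp := jet2_ln _ jp.
have {}jm := jet2_ln _ jm.
rewrite !(mul0r, addr0, add0r, sub0r, expr0n, mulr0)/= in jp jm.
have := jet2Z 2^-1 (jet2B (jp p0) (jm m0)).
rewrite (_ : _ * (a / _ - - a / _) = a / (1 - f 0 ^+ 2)); last by field; exact/and3P.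
rewrite (_ : _ * (b / _ - _ - _) =
   2 * f 0 * (a / (1 - f 0 ^+ 2)) ^+ 2 + b / (1 - f 0 ^+ 2)); last by field; exact/and3P.
apply: jet2_near_eq; near=> s.
by rewrite !(mul0r, addr0) mulrC.
Unshelve. all: by end_near. Qed.

Definition gap {R : realType} {n : nat} (x : 'rV[R]_n) : R := 1 - dot x x.

(** The square of [sinh (d / 2)], where [d] is the hyperbolic distance. *)
Definition hratio {R : realType} {n : nat} (x y : 'rV[R]_n) : R :=
  dot (x - y) (x - y) / (gap x * gap y).

Definition sinh_half {R : realType} {n : nat} (x y : 'rV[R]_n) : R :=
  Num.sqrt (hratio x y).

Definition cosh_half {R : realType} {n : nat} (x y : 'rV[R]_n) : R :=
  Num.sqrt (1 + hratio x y).

(** Closed form of the hyperbolic distance, [2 * arsinh (sinh_half x y)]. *)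
Definition hdist {R : realType} {n : nat} (x y : 'rV[R]_n) : R :=
  2 * ln (sinh_half x y + cosh_half x y).

(** The distance as a function of the logarithm of [hratio]: this logarithm is a
    sum of logarithms of quadratic functions along any pair of lines. *)
Definition dist_of_log {R : realType} (t : R) : R :=
  2 * ln (expR (t / 2) + Num.sqrt (1 + expR t)).

Lemma dist_of_log_ln {R : realType} (r : R) : 0 < r ->
  dist_of_log (ln r) = 2 * ln (Num.sqrt r + Num.sqrt (1 + r)).
Proof.
move=> r0; rewrite /dist_of_log lnK ?posrE//; congr (_ * ln (_ + _)).
have s0 : 0 < Num.sqrt r by rewrite sqrtr_gt0.
rewrite -{1}(sqr_sqrtr (ltW r0)) lnXn// -[ln _ *+ 2]mulr_natr mulfK//.
by rewrite lnK ?posrE.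
Qed.

Lemma jet2_dist_of_log {R : realType} (f : R -> R) (a b s c : R) :
  s = expR (f 0 / 2) -> c = Num.sqrt (1 + expR (f 0)) -> jet2 f a b ->
  jet2 (fun t => dist_of_log (f t)) (s / c * a)
    (s / (2 * c ^+ 3) * a ^+ 2 + s / c * b).
Proof.
pose es (t : R) := expR (t / 2); pose cs (t : R) := Num.sqrt (1 + expR t).
have es0 t : 0 < es t by exact: expR_gt0.
have c0 t : 0 < 1 + expR t :> R by rewrite addr_gt0// expR_gt0.
have cs0 t : 0 < cs t by rewrite sqrtr_gt0.
have esE t : es t ^+ 2 = expR t by rewrite -expRM_natl -mulr_natl mulrC divfK.
have csE t : cs t ^+ 2 = 1 + es t ^+ 2 by rewrite sqr_sqrtr ?esE// ltW.
have des (t : R) : is_derive t 1 es (es t / 2).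
  have dh : is_derive t 1 (fun u : R => u / 2) 2^-1.
    have := is_deriveZ 2^-1 (is_derive_id t (1 : R)).
    rewrite (_ : 2^-1 \*: id = fun u => u / 2); last first.
      by apply/funext => u; rewrite /= mulrC.
    by move=> d2; apply: (is_derive_eq d2); rewrite /GRing.scale/= mulr1.
  have d := @is_derive1_comp R expR (fun u => u / 2) t _ _ (is_derive_expR _) dh.
  exact: (is_derive_eq d).
have dcs (t : R) : is_derive t 1 cs (es t ^+ 2 / (2 * cs t)).
  have d1 : is_derive t 1 (fun u => 1 + expR u) (expR t).
    have d1' := is_deriveD (is_derive_cst (1 : R) t 1) (is_derive_expR t).
    by apply: (is_derive_eq d1'); rewrite add0r.
  have d2 := @is_derive1_comp R Num.sqrt (fun u => 1 + expR u) t _ _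
    (is_derive1_sqrt (c0 t)) d1.
  by apply: (is_derive_eq d2); rewrite esE mulrC.
have nz t : (es t != 0) * (cs t != 0) * (es t + cs t != 0).
  by rewrite !gt_eqF// addr_gt0.
have dF (t : R) : is_derive t 1 dist_of_log (es t / cs t).
  have d1 := is_derive1_ln (addr_gt0 (es0 t) (cs0 t)).
  have d2 := is_deriveZ 2 (@is_derive1_comp R (@ln R) (es + cs) t _ _ d1
    (is_deriveD (des t) (dcs t))).
  apply: (is_derive_eq d2); rewrite /GRing.scale/=.
  by field; rewrite !nz.
have ddF (t : R) : is_derive t 1 (fun u => es u / cs u) (es t / (2 * cs t ^+ 3)).
  have d1 := is_deriveM (des t) (is_deriveV (nz t).1.2 (dcs t)).
  apply: (is_derive_eq d1); rewrite /GRing.scale/=.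
  rewrite (_ : es t / (2 * _) = es t * (cs t ^+ 2 - es t ^+ 2) / (2 * cs t ^+ 3)).
    by field; rewrite nz.
  by rewrite csE addrK mulr1.
move=> -> -> jf.
by apply: (jet2_comp _ (ddF _) jf); near=> t; exact: dF.
Unshelve. all: by end_near. Qed.

Lemma jet2_dot_line {R : realType} {n : nat} (x u : 'rV[R]_n) :
  jet2 (fun s => dot (x + s *: u) (x + s *: u)) (2 * dot x u) (2 * dot u u).
Proof.
have := jet2_quadratic (dot x x) (2 * dot x u) (dot u u).
apply: jet2_near_eq; near=> s; rewrite !dotE (dotC u x); ring.
Unshelve. all: by end_near. Qed.

Lemma jet2_ln_dot {R : realType} {n : nat} (x u : 'rV[R]_n) : x != 0 ->
  jet2 (fun s => ln (dot (x + s *: u) (x + s *: u)))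
    (2 * dot x u / dot x x)
    (2 * dot u u / dot x x - (2 * dot x u / dot x x) ^+ 2).
Proof.
move=> x0; have := jet2_ln _ (jet2_dot_line x u).
by rewrite scale0r addr0 dot_gt0; apply.
Qed.

Lemma jet2_ln_gap {R : realType} {n : nat} (x u : 'rV[R]_n) :
  0 < gap x ->
  jet2 (fun s => ln (gap (x + s *: u)))
    (- (2 * dot x u / gap x))
    (- (2 * dot u u / gap x + (2 * dot x u / gap x) ^+ 2)).
Proof.
move=> x1; have := jet2B (jet2_quadratic 1 0 0) (jet2_dot_line x u).
rewrite !(mulr0, sub0r).
move/jet2_ln; rewrite !(mul0r, addr0) scale0r addr0 => /(_ x1).
rewrite !mulNr sqrrN opprD; apply: jet2_near_eq; near=> s.
by rewrite !mul0r !addr0.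
Unshelve. all: by end_near. Qed.

Lemma hratio_ge0 {R : realType} {n : nat} (x y : 'rV[R]_n) :
  unit_ball R n x -> unit_ball R n y -> 0 <= hratio x y.
Proof.
move=> /unit_ballE Px /unit_ballE Py.
by rewrite divr_ge0 ?dot_ge0// ltW// mulr_gt0.
Qed.

Lemma hratio_gt0 {R : realType} {n : nat} (x y : 'rV[R]_n) :
  unit_ball R n x -> unit_ball R n y -> x != y -> 0 < hratio x y.
Proof.
move=> /unit_ballE Px /unit_ballE Py xy.
by rewrite divr_gt0 ?dot_gt0 ?subr_eq0// mulr_gt0.
Qed.

Lemma ln_ratio {R : realType} (a b c : R) : 0 < a -> 0 < b -> 0 < c ->
  ln (a / (b * c)) = ln a - ln b - ln c.
Proof.
move=> a0 b0 c0.
by rewrite ln_div ?posrE ?mulr_gt0// lnM ?posrE// opprD addrA.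
Qed.

Lemma hdistE {R : realType} {n : nat} (x y : 'rV[R]_n) :
  unit_ball R n x -> unit_ball R n y -> x != y ->
  hdist x y = dist_of_log (ln (dot (x - y) (x - y)) - ln (gap x) - ln (gap y)).
Proof.
move=> bx byy xy; rewrite /hdist /sinh_half /cosh_half -dist_of_log_ln ?hratio_gt0//.
move: bx byy => /unit_ballE Px /unit_ballE Py.
have Nx : 0 < dot (x - y) (x - y) by rewrite dot_gt0 subr_eq0.
by rewrite /hratio ln_ratio.
Qed.

(** First and second derivatives at [0] of the logarithm of
    [hratio (x + t u) (y + t v)]. *)
Definition dln_hratio {R : realType} {n : nat} (x y u v : 'rV[R]_n) : R :=
  2 * dot (x - y) (u - v) / dot (x - y) (x - y)
  + 2 * dot x u / gap x + 2 * dot y v / gap y.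

Definition ddln_hratio {R : realType} {n : nat} (x y u v : 'rV[R]_n) : R :=
  (2 * dot (u - v) (u - v) / dot (x - y) (x - y)
   - (2 * dot (x - y) (u - v) / dot (x - y) (x - y)) ^+ 2)
  + (2 * dot u u / gap x + (2 * dot x u / gap x) ^+ 2)
  + (2 * dot v v / gap y + (2 * dot y v / gap y) ^+ 2).

Lemma jet2_hdist {R : realType} {n : nat} (x y u v : 'rV[R]_n) :
  unit_ball R n x -> unit_ball R n y -> x != y ->
  jet2 (fun t => hdist (x + t *: u) (y + t *: v))
    (sinh_half x y / cosh_half x y * dln_hratio x y u v)
    (sinh_half x y / (2 * cosh_half x y ^+ 3) * dln_hratio x y u v ^+ 2
     + sinh_half x y / cosh_half x y * ddln_hratio x y u v).
Proof.
move=> bx byy xy.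
move: (bx) (byy) => /unit_ballE Px /unit_ballE Py.
have z0 : x - y != 0 by rewrite subr_eq0.
have Nx : 0 < dot (x - y) (x - y) by rewrite dot_gt0.
pose f t := ln (dot (x - y + t *: (u - v)) (x - y + t *: (u - v)))
  - ln (gap (x + t *: u)) - ln (gap (y + t *: v)).
have jf : jet2 f (dln_hratio x y u v) (ddln_hratio x y u v).
  have := jet2B (jet2B (jet2_ln_dot (u - v) z0) (jet2_ln_gap u Px))
                (jet2_ln_gap v Py).
  by rewrite !opprK.
have f0 : f 0 = ln (hratio x y).
  by rewrite /f !scale0r !addr0 /hratio ln_ratio.
have r0 : 0 < hratio x y by exact: hratio_gt0.
have sE : sinh_half x y = expR (f 0 / 2).
  rewrite f0 /sinh_half -{1}(sqr_sqrtr (ltW r0)) sqrtr_sqr ger0_norm ?sqrtr_ge0//.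
  rewrite -{2}(sqr_sqrtr (ltW r0)) lnXn ?sqrtr_gt0//.
  by rewrite -[ln _ *+ 2]mulr_natr mulfK// lnK ?posrE ?sqrtr_gt0.
have cE : cosh_half x y = Num.sqrt (1 + expR (f 0)) by rewrite f0 lnK.
have := jet2_dist_of_log sE cE jf.
apply: jet2_near_eq.
have bxt := near_line u open_unit_ball bx.
have byt := near_line v open_unit_ball byy.
have zt : \forall t \near (0 : R), x - y + t *: (u - v) != 0.
  have cz := jet2_continuous (jet2_dot_line (x - y) (u - v)).
  have d0 : 0 < dot (x - y + 0 *: (u - v)) (x - y + 0 *: (u - v)).
    by rewrite scale0r addr0.
  have := cz _ (lt_nbhsr d0); rewrite /= near_simpl => zt.
  by near=> t; rewrite -dot_gt0; near: t.
near=> t.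
have bt1 : unit_ball R n (x + t *: u) by near: t.
have bt2 : unit_ball R n (y + t *: v) by near: t.
have zt0 : x - y + t *: (u - v) != 0 by near: t.
have E : x + t *: u - (y + t *: v) = x - y + t *: (u - v).
  by rewrite scalerBr opprD addrACA.
have ne : x + t *: u != y + t *: v by rewrite -subr_eq0 E.
by rewrite /f (hdistE bt1 bt2 ne) E.
Unshelve. all: by end_near. Qed.

(** The last term is a barrier, which tends to [-oo] at the boundary of the ball
    although its hyperbolic gradient and Laplacian remain bounded. *)
Definition two_point {R : realType} {n : nat} (h : 'rV[R]_n -> R) (K e : R)
    (x y : 'rV[R]_n) : R :=
  artanh (h x) - artanh (h y) - K * hdist x y + e * (ln (gap x) + ln (gap y)).

Section LineDerivatives.
Context {R : realType} {n : nat}.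
Implicit Types (h : 'rV[R]_n -> R) (x u v : 'rV[R]_n).

Definition hess2 h x u : R :=
  \sum_(i < n) u ord0 i * \sum_(j < n) u ord0 j * partial j (partial i h) x.

(** The gradient of [artanh \o h]. *)
Definition agrad h x : 'rV[R]_n := (1 - h x ^+ 2)^-1 *: gradient h x.

Lemma jet2_artanh_line h x u :
  (forall z, unit_ball R n z -> -1 < h z < 1) -> C2_on (unit_ball R n) h ->
  unit_ball R n x ->
  jet2 (fun s => artanh (h (x + s *: u))) (dot u (agrad h x))
    (2 * h x * dot u (agrad h x) ^+ 2 + (1 - h x ^+ 2)^-1 * hess2 h x u).
Proof.
move=> hr Ch bx; have := jet2_artanh _ (C2_jet2 u open_unit_ball Ch bx).
rewrite scale0r addr0 => /(_ (hr _ bx)).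
rewrite /agrad dotZr /hess2 mulrC.
rewrite (_ : dot u (gradient h x) = \sum_(i < n) u ord0 i * partial i h x).
  by rewrite ![_ / (1 - h x ^+ 2)]mulrC.
by apply: eq_bigr => i _; rewrite mxE.
Qed.

End LineDerivatives.

(** First- and second-order conditions at a maximum, tested by moving the two
    points along lines with arbitrary directions [u] and [v]. *)
Lemma two_point_max {R : realType} {n : nat} (h : 'rV[R]_n -> R) (K e : R)
    (x y u v : 'rV[R]_n) :
  (forall z, unit_ball R n z -> -1 < h z < 1) -> C2_on (unit_ball R n) h ->
  unit_ball R n x -> unit_ball R n y -> x != y ->
  (forall x' y', unit_ball R n x' -> unit_ball R n y' ->
     two_point h K e x' y' <= two_point h K e x y) ->
  dot u (agrad h x) - dot v (agrad h y)
    - K * (sinh_half x y / cosh_half x y * dln_hratio x y u v)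
    - e * (2 * dot x u / gap x + 2 * dot y v / gap y) = 0 /\
  (2 * h x * dot u (agrad h x) ^+ 2 + (1 - h x ^+ 2)^-1 * hess2 h x u)
  - (2 * h y * dot v (agrad h y) ^+ 2 + (1 - h y ^+ 2)^-1 * hess2 h y v)
  - K * (sinh_half x y / (2 * cosh_half x y ^+ 3) * dln_hratio x y u v ^+ 2
         + sinh_half x y / cosh_half x y * ddln_hratio x y u v)
  - e * ((2 * dot u u / gap x + (2 * dot x u / gap x) ^+ 2)
         + (2 * dot v v / gap y + (2 * dot y v / gap y) ^+ 2)) <= 0.
Proof.
move=> hr Ch bx byy xy hmax.
move: (bx) (byy) => /unit_ballE Px /unit_ballE Py.
have jx := jet2_artanh_line u hr Ch bx.
have jy := jet2_artanh_line v hr Ch byy.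
have jd := jet2Z K (jet2_hdist u v bx byy xy).
have jb := jet2Z e (jet2D (jet2_ln_gap u Px) (jet2_ln_gap v Py)).
have /jet2_max := jet2D (jet2B (jet2B jx jy) jd) jb.
rewrite -!opprD !mulrN; apply.
have bxt := near_line u open_unit_ball bx.
have byt := near_line v open_unit_ball byy.
apply: filterS2 bxt byt => t bt1 bt2; rewrite !scale0r !addr0.
exact: hmax.
Qed.

(** * The inequality at a maximum of the two-point function *)

(** Image of the [k]-th basis vector under the reflection in the hyperplane
    orthogonal to [z]. *)
Definition refl {R : realType} {n : nat} (z : 'rV[R]_n) (k : 'I_n) : 'rV[R]_n :=
  delta_mx ord0 k - (2 * z ord0 k / dot z z) *: z.

Section Reflection.
Context {R : realType} {n : nat}.
Implicit Types (x y z g : 'rV[R]_n) (k : 'I_n).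

Lemma sum_quadratic x y (A B C D : R) :
  \sum_(k < n) (A * x ord0 k ^+ 2 + B * (x ord0 k * y ord0 k)
                + C * y ord0 k ^+ 2 + D) =
  A * dot x x + B * dot x y + C * dot y y + n%:R * D.
Proof.
rewrite !big_split/= sumr_const card_ord mulr_natl -!mulr_sumr.
by under eq_bigr do rewrite expr2; under [in X in _ + X + _]eq_bigr do rewrite expr2.
Qed.

Lemma dot_refl z k g :
  dot g (refl z k) = g ord0 k - 2 * z ord0 k / dot z z * dot g z.
Proof. by rewrite /refl !dotE dot_delta. Qed.

Lemma dot_refl_refl z k : z != 0 -> dot (refl z k) (refl z k) = 1.
Proof.
rewrite -dot_gt0 => /gt_eqF/negbT z0.
rewrite dot_refl (dotC _ z) dot_refl !mxE !eqxx/=; field.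
exact: z0.
Qed.

(** The reflected basis is orthonormal, so that summing a bilinear form over it
    gives the trace. *)
Lemma sum_refl z (M : 'I_n -> 'I_n -> R) : z != 0 ->
  \sum_(k < n) \sum_(i < n) refl z k ord0 i *
    (\sum_(j < n) refl z k ord0 j * M j i) = \sum_(i < n) M i i.
Proof.
rewrite -dot_gt0 => /gt_eqF/negbT z0.
have orth i j : \sum_(k < n) refl z k ord0 i * refl z k ord0 j = (i == j)%:R.
  have -> : (i == j)%:R = dot (refl z i) (refl z j).
    rewrite dot_refl (dotC _ z) dot_refl !mxE !eqxx/= [i == j]eq_sym; field.
    exact: z0.
  apply: eq_bigr => k _; rewrite !mxE !eqxx/= ![k == _]eq_sym.
  by congr (_ * _); ring.
under eq_bigr => k _ do under eq_bigr => i _ do rewrite mulr_sumr.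
rewrite exchange_big/=; apply: eq_bigr => i _.
rewrite exchange_big/= (bigD1 i)//= [X in _ + X]big1 ?addr0 => [|j ji].
  under eq_bigr do rewrite mulrA.
  by rewrite -mulr_suml orth eqxx mul1r.
under eq_bigr do rewrite mulrA.
by rewrite -mulr_suml orth eq_sym (negbTE ji) mul0r.
Qed.

Lemma sum_hess2_delta (h : 'rV[R]_n -> R) x (a : R) :
  \sum_(k < n) hess2 h x (a *: delta_mx ord0 k) = a ^+ 2 * laplacian h x.
Proof.
rewrite /laplacian mulr_sumr; apply: eq_bigr => k _.
rewrite /hess2 (bigD1 k)//= [X in _ + X]big1 => [|i ik]; last first.
  by rewrite !mxE (negbTE ik) andbF mulr0 mul0r.
rewrite (bigD1 k)//= [X in _ * (_ + X)]big1 => [|i ik]; last first.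
  by rewrite !mxE (negbTE ik) andbF mulr0 mul0r.
by rewrite !mxE !eqxx mulr1 !addr0 mulrA expr2.
Qed.

Lemma sum_hess2_refl (h : 'rV[R]_n -> R) x z (a : R) : z != 0 ->
  \sum_(k < n) hess2 h x (a *: refl z k) = a ^+ 2 * laplacian h x.
Proof.
move=> z0; rewrite /laplacian -(sum_refl (fun j i => partial j (partial i h) x) z0).
rewrite mulr_sumr; apply: eq_bigr => k _; rewrite /hess2 mulr_sumr.
apply: eq_bigr => i _.
under eq_bigr do rewrite mxE -mulrA.
by rewrite -mulr_sumr mxE; ring.
Qed.

Lemma sum_dot_refl z g : z != 0 ->
  \sum_(k < n) dot g (refl z k) ^+ 2 = dot g g.
Proof.
rewrite -dot_gt0 => /gt_eqF/negbT z0.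
transitivity (\sum_(k < n) (1 * g ord0 k ^+ 2
  + (- (4 * dot g z / dot z z)) * (g ord0 k * z ord0 k)
  + (4 * dot g z ^+ 2 / dot z z ^+ 2) * z ord0 k ^+ 2 + 0)).
  by apply: eq_bigr => k _; rewrite dot_refl; field.
rewrite sum_quadratic; field; exact: z0.
Qed.

End Reflection.

Lemma dot_comb {R : realType} {n : nat} (x z : 'rV[R]_n) (a b : R) :
  dot (a *: z + b *: x) (a *: z + b *: x) =
  a ^+ 2 * dot z z + 2 * a * b * dot x z + b ^+ 2 * dot x x.
Proof. by rewrite !(dotDl, dotDr, dotZl, dotZr) (dotC z x); ring. Qed.

Lemma hyp_harmonic_agrad {R : realType} {n : nat} (h : 'rV[R]_n -> R)
    (x : 'rV[R]_n) : hyp_harmonic h -> unit_ball R n x ->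
  gap x ^+ 2 * ((1 - h x ^+ 2)^-1 * laplacian h x) =
  - (2 * (n%:R - 2) * gap x * dot x (agrad h x)).
Proof.
move=> [_ hh] /hh; rewrite /hyp_laplacian enorm_sqr -/(gap x).
rewrite (_ : \sum_(i < n) _ = dot x (gradient h x)); last first.
  by apply: eq_bigr => i _; rewrite mxE.
move=> /eqP; rewrite addr_eq0 => /eqP E.
by rewrite mulrCA E /agrad dotZr; ring.
Qed.

Lemma sinh_cosh_half {R : realType} {n : nat} (x y : 'rV[R]_n) :
  unit_ball R n x -> unit_ball R n y -> x != y ->
  [/\ 0 < sinh_half x y, 0 < cosh_half x y, sinh_half x y ^+ 2 = hratio x y
    & cosh_half x y ^+ 2 = 1 + sinh_half x y ^+ 2].
Proof.
move=> bx byy xy; have r0 := hratio_gt0 bx byy xy.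
have r1 : 0 < 1 + hratio x y by rewrite addr_gt0.
by rewrite /cosh_half /sinh_half !sqrtr_gt0 !sqr_sqrtr ?ltW.
Qed.

(** The gradient at [x] of [K * hdist x y - e * ln (gap x)]. At a maximum
    [(x, y)] of the two-point function it is the gradient of [artanh \o h] at
    [x], and [- dist_grad K e y x] is the gradient at [y]. *)
Definition dist_grad {R : realType} {n : nat} (K e : R) (x y : 'rV[R]_n) :=
  (2 * K * (sinh_half x y / cosh_half x y) / dot (x - y) (x - y)) *: (x - y)
  + ((2 * K * (sinh_half x y / cosh_half x y) + 2 * e) / gap x) *: x.

Section MaximumInequality.
Context {R : realType} {n : nat}.
Context (x y : 'rV[R]_n).
Context (bx : unit_ball R n x) (byy : unit_ball R n y) (xy : x != y).
Local Notation P := (gap x).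
Local Notation Q := (gap y).
Local Notation N := (dot (x - y) (x - y)).
Local Notation s := (sinh_half x y).
Local Notation c := (cosh_half x y).
Local Notation z := (x - y).

Let P0 : 0 < P. Proof. exact/unit_ballE. Qed.
Let Q0 : 0 < Q. Proof. exact/unit_ballE. Qed.
Let N0 : 0 < N. Proof. by rewrite dot_gt0 subr_eq0. Qed.
Let s0 : 0 < s. Proof. by have [] := sinh_cosh_half bx byy xy. Qed.
Let c0 : 0 < c. Proof. by have [] := sinh_cosh_half bx byy xy. Qed.
Let cE : c ^+ 2 = 1 + s ^+ 2. Proof. by have [] := sinh_cosh_half bx byy xy. Qed.
Let nz : (s != 0) * (c != 0) * (P != 0) * (Q != 0) * (N != 0).
Proof. by rewrite !gt_eqF. Qed.
Let NE : N = s ^+ 2 * (P * Q).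
Proof.
have [_ _ -> _] := sinh_cosh_half bx byy xy.
by rewrite /hratio divfK// mulf_neq0 ?nz.
Qed.
Let xxE : dot x x = 1 - P. Proof. by rewrite /gap opprB addrC subrK. Qed.
Let yyE : dot y y = 1 - Q. Proof. by rewrite /gap opprB addrC subrK. Qed.
Let xyE : dot x y = (2 - P - Q - N) / 2.
Proof. by rewrite /gap !dotE (dotC y x); field. Qed.
Let xzE : dot x z = (N + Q - P) / 2.
Proof. by rewrite dotDr dotNr xyE xxE; field. Qed.
Let yzE : dot y z = (Q - P - N) / 2.
Proof. by rewrite dotDr dotNr dotC xyE yyE; field. Qed.

(** The distance has hyperbolic gradient of norm [1]: the vector [X] below has
    Euclidean norm [coth (d / 2)]. The barrier only contributes terms in [e]. *)
Lemma dist_grad_norm (K e : R) : 0 <= K -> 0 <= e ->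
  `|P ^+ 2 * dot (dist_grad K e x y) (dist_grad K e x y) - 4 * K ^+ 2|
    <= 8 * K * e + 4 * e ^+ 2.
Proof.
move=> K0 e0.
pose X := (P / N) *: z + x.
have XX : s ^+ 2 * dot X X = c ^+ 2.
  have -> : dot X X = (P / N) ^+ 2 * N + 2 * (P / N) * dot x z + dot x x.
    by rewrite /X -[X in _ + X]scale1r dot_comb; ring.
  by rewrite xzE xxE cE NE; field; rewrite !nz.
have GE : P *: dist_grad K e x y = (2 * K * (s / c)) *: X + (2 * e) *: x.
  rewrite /dist_grad /X scalerDr [in RHS]scalerDr !scalerA -addrA -scalerDl.
  by congr (_ *: _ + _ *: _); field; rewrite !nz.
have -> : P ^+ 2 * dot (dist_grad K e x y) (dist_grad K e x y) = 4 * K ^+ 2 +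
    (8 * K * e * (s / c * dot x X) + 4 * e ^+ 2 * dot x x).
  transitivity (dot (P *: dist_grad K e x y) (P *: dist_grad K e x y)).
    by rewrite dotZl dotZr mulrA expr2.
  rewrite GE dot_comb.
  have -> : dot X X = c ^+ 2 / s ^+ 2 by rewrite -XX mulrC mulKf// expf_neq0// nz.
  by field; rewrite !nz.
have x1 : enorm x <= 1 by exact: ltW.
have sXc : `|s / c * dot x X| <= 1.
  have sc0 : 0 <= s / c by rewrite divr_ge0// ltW.
  have sX : s / c * enorm X = 1.
    apply: (@mulIf _ c); rewrite ?nz// mul1r mulrAC divfK ?nz//.
    apply/eqP; rewrite -(@eqrXn2 _ 2) ?mulr_ge0 ?enorm_ge0 ?ltW//.
    by rewrite exprMn enorm_sqr XX.
  rewrite normrM (ger0_norm sc0) -[leRHS]sX ler_wpM2l//.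
  rewrite (le_trans (cauchy_schwarz _ _))//.
  by rewrite ler_piMl ?enorm_ge0.
rewrite addrAC subrr add0r (le_trans (ler_normD _ _))// lerD//.
- by rewrite normrM ger0_norm ?mulr_ge0// ler_piMr// !mulr_ge0.
- rewrite ger0_norm ?mulr_ge0 ?dot_ge0 ?exprn_ge0//.
  by rewrite ler_piMr ?mulr_ge0 ?exprn_ge0// xxE gerBl ltW.
Qed.

Lemma dot_dist_grad (K e : R) :
  P * dot x (dist_grad K e x y) =
  2 * K * (s / c) * (P * dot x z / N + dot x x) + 2 * e * dot x x.
Proof.
have E A B w : dot x (A *: w + B *: x) = A * dot x w + B * dot x x.
  by rewrite dotDr !dotZr.
by rewrite /dist_grad E; field; rewrite !nz.
Qed.

(* The reflection in the perpendicular bisector of [x] and [y] preserves the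
   circle carrying the hyperbolic geodesic from [x] to [y]. Hence its linear part
   [refl (x - y)] sends the tangent vector at [x] to the opposite of the tangent
   vector at [y], and agrees with parallel transport on normal vectors. The
   factors [P] and [Q] are those of the conformal metric. *)
Context (a b : R).
Local Notation u k := ((a * P) *: (delta_mx ord0 k : 'rV[R]_n)).
Local Notation v k := ((b * Q) *: refl z k).

Let zk k : z ord0 k = x ord0 k - y ord0 k. Proof. by rewrite !mxE. Qed.

Let dot_zuv k : dot z (u k - v k) = (a * P + b * Q) * z ord0 k.
Proof.
rewrite dotDr dotNr !dotZr dot_delta dot_refl.
by field; rewrite !nz.
Qed.

Let dot_uv k : dot (u k - v k) (u k - v k) = (a * P) ^+ 2 + (b * Q) ^+ 2
  - 2 * (a * P) * (b * Q) * (1 - 2 * z ord0 k ^+ 2 / N).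
Proof.
have z0 : z != 0 by rewrite subr_eq0.
have E p q : dot (p - q) (p - q) = dot p p - 2 * dot q p + dot q q.
  by rewrite !dotE (dotC p q); ring.
rewrite E !dotZl !dotZr dot_refl_refl// !dot_delta !mxE !eqxx/=.
by field; rewrite !nz.
Qed.

Lemma sum_barrier_x : \sum_(k < n) (2 * dot (u k) (u k) / P + (2 * dot x (u k) / P) ^+ 2)
  = a ^+ 2 * (2 * n%:R * P + 4 * (1 - P)).
Proof.
transitivity (\sum_(k < n) (4 * a ^+ 2 * x ord0 k ^+ 2 + 0 * (x ord0 k * y ord0 k)
   + 0 * y ord0 k ^+ 2 + 2 * a ^+ 2 * P)).
  apply: eq_bigr => k _; rewrite !dotZl !dotZr !dot_delta !mxE !eqxx/=.
  by field; rewrite !nz.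
by rewrite sum_quadratic xxE; ring.
Qed.

Lemma sum_barrier_y : \sum_(k < n) (2 * dot (v k) (v k) / Q + (2 * dot y (v k) / Q) ^+ 2)
  = b ^+ 2 * (2 * n%:R * Q + 4 * (1 - Q)).
Proof.
have z0 : z != 0 by rewrite subr_eq0.
transitivity (\sum_(k < n) (2 * b ^+ 2 * Q + 4 * b ^+ 2 * dot y (refl z k) ^+ 2)).
  apply: eq_bigr => k _; rewrite !dotZl !dotZr dot_refl_refl//.
  by field; rewrite !nz.
rewrite big_split/= sumr_const card_ord -mulr_sumr sum_dot_refl// yyE.
by rewrite -mulr_natr; ring.
Qed.

Lemma sum_dln_hratio :
  \sum_(k < n) dln_hratio x y (u k) (v k) ^+ 2 = 4 * (a + b) ^+ 2 * (c / s) ^+ 2.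
Proof.
pose A := 2 * (a * P + b * Q) / N + 2 * a - 2 * b * (2 * dot y z / N).
pose B := 2 * b + 2 * b * (2 * dot y z / N) - 2 * (a * P + b * Q) / N.
have E k : dln_hratio x y (u k) (v k) = A * x ord0 k + B * y ord0 k.
  rewrite /dln_hratio dot_zuv !dotZr dot_delta dot_refl zk /A /B.
  by field; rewrite !nz.
transitivity (\sum_(k < n) (A ^+ 2 * x ord0 k ^+ 2
    + 2 * A * B * (x ord0 k * y ord0 k) + B ^+ 2 * y ord0 k ^+ 2 + 0)).
  by apply: eq_bigr => k _; rewrite E; ring.
rewrite sum_quadratic mulr0 addr0 expr_div_n cE /A /B yzE xxE yyE xyE NE.
by field; rewrite !nz.
Qed.

Lemma sum_ddln_hratio :
  \sum_(k < n) ddln_hratio x y (u k) (v k) =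
  a ^+ 2 * (2 * (n%:R - 2) * P ^+ 2 / N + 2 * n%:R * P + 4 * (1 - P))
  + b ^+ 2 * (2 * (n%:R - 2) * Q ^+ 2 / N + 2 * n%:R * Q + 4 * (1 - Q))
  - 4 * n%:R * (a * b) * (P * Q / N).
Proof.
rewrite big_split big_split/= sum_barrier_x sum_barrier_y.
rewrite (_ : \sum_(k < n) _ = \sum_(k < n)
  ((8 * (a * P) * (b * Q) / N ^+ 2 - 4 * (a * P + b * Q) ^+ 2 / N ^+ 2) * z ord0 k ^+ 2
   + 0 * (z ord0 k * z ord0 k) + 0 * z ord0 k ^+ 2
   + 2 * ((a * P) ^+ 2 + (b * Q) ^+ 2 - 2 * (a * P) * (b * Q)) / N)); last first.
  by apply: eq_bigr => k _; rewrite dot_uv dot_zuv; field; rewrite !nz.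
by rewrite sum_quadratic; field; rewrite !nz.
Qed.

End MaximumInequality.

Lemma hratioC {R : realType} {n : nat} (x y : 'rV[R]_n) : hratio x y = hratio y x.
Proof.
by rewrite /hratio mulrC [gap y * _]mulrC -opprB dotNl dotNr opprK mulrC.
Qed.

(** The left-hand side comes from the Laplacian of [artanh \o h] at the two
    points, and the first term on the right from the second variation of the
    distance [d]: the quotient is [((a^2 + b^2) cosh d - 2 a b) / sinh d]. The
    last term bounds the contribution of the barrier. *)
Lemma two_point_inequality {R : realType} {n : nat} (h : 'rV[R]_n -> R)
    (K e : R) (x y : 'rV[R]_n) (a b : R) : (2 <= n)%N ->
  (forall z, unit_ball R n z -> -1 < h z < 1) -> hyp_harmonic h ->
  unit_ball R n x -> unit_ball R n y -> x != y -> 0 <= K -> 0 <= e ->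
  (forall x' y', unit_ball R n x' -> unit_ball R n y' ->
     two_point h K e x' y' <= two_point h K e x y) ->
  8 * K ^+ 2 * (a ^+ 2 * h x - b ^+ 2 * h y) <=
  4 * (n%:R - 1) * K * (((a ^+ 2 + b ^+ 2) * (1 + 2 * sinh_half x y ^+ 2)
                         - 2 * (a * b)) / (2 * sinh_half x y * cosh_half x y))
  + e * (16 * K + 8 * e + 4 * n%:R) * (a ^+ 2 + b ^+ 2).
Proof.
move=> n2 hr hh bx byy xy K0 e0 hmax.
have yx : y != x by rewrite eq_sym.
have tpm u v := two_point_max u v hr hh.1 bx byy xy hmax.
have [s0 c0 sE cE] := sinh_cosh_half bx byy xy.
move: (bx) (byy) => /unit_ballE Px /unit_ballE Py.
have sC : sinh_half y x = sinh_half x y by rewrite /sinh_half hratioC.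
have cC : cosh_half y x = cosh_half x y by rewrite /cosh_half hratioC.
have NC : dot (y - x) (y - x) = dot (x - y) (x - y).
  by rewrite -opprB dotNl dotNr opprK.
have N0 : 0 < dot (x - y) (x - y) by rewrite dot_gt0 subr_eq0.
have dot0 (w : 'rV[R]_n) : (dot 0 w = 0) * (dot w 0 = 0).
  by rewrite -(scale0r (0 : 'rV[R]_n)) dotZl dotZr !mul0r.
have dotd (w : 'rV[R]_n) k : dot (delta_mx ord0 k) w = w ord0 k by rewrite dotC dot_delta.
have gx : agrad h x = dist_grad K e x y.
  apply/rowP => k; have [+ _] := tpm (delta_mx ord0 k) 0.
  rewrite /dln_hratio subr0 !dot0 dotd !dot_delta /dist_grad !mxE.
  rewrite !(mulr0, mul0r, addr0, subr0) => /eqP.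
  rewrite subr_eq0 subr_eq => /eqP ->.
  by field; rewrite !gt_eqF.
have gy : agrad h y = - dist_grad K e y x.
  apply/rowP => k; have [+ _] := tpm 0 (delta_mx ord0 k).
  rewrite /dln_hratio sub0r !dot0 dotNr dotd !dot_delta /dist_grad sC cC NC !mxE.
  rewrite !(mulr0, mul0r, addr0, sub0r, add0r) -!opprD => /eqP.
  rewrite oppr_eq0 -addrA addr_eq0 => /eqP ->.
  by field; rewrite !gt_eqF.
have := dist_grad_norm bx byy xy K0 e0.
have := dist_grad_norm byy bx yx K0 e0.
have Lx := hyp_harmonic_agrad hh bx.
have Ly := hyp_harmonic_agrad hh byy.
have Dx := dot_dist_grad bx byy xy K e.
have Dy := dot_dist_grad byy bx yx K e.
have Sx := sum_barrier_x bx byy xy a.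
have Sy := sum_barrier_y bx byy xy b.
have T1 := sum_dln_hratio bx byy xy a b.
have T2 := sum_ddln_hratio bx byy xy a b.
have z0 : x - y != 0 by rewrite subr_eq0.
pose u k := (a * gap x) *: delta_mx ord0 k : 'rV[R]_n.
pose v k := (b * gap y) *: refl (x - y) k.
have Ex : \sum_(k < n) dot (u k) (agrad h x) ^+ 2
    = (a * gap x) ^+ 2 * dot (agrad h x) (agrad h x).
  rewrite {2}/dot mulr_sumr; apply: eq_bigr => k _.
  by rewrite /u dotZl dotd exprMn expr2.
have Ey : \sum_(k < n) dot (v k) (agrad h y) ^+ 2
    = (b * gap y) ^+ 2 * dot (agrad h y) (agrad h y).
  rewrite -(sum_dot_refl (agrad h y) z0) mulr_sumr; apply: eq_bigr => k _.
  by rewrite /v dotZl exprMn dotC.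
have Hx := sum_hess2_delta h x (a * gap x).
have Hy := sum_hess2_refl h y (b * gap y) z0.
have H : 2 * h x * ((a * gap x) ^+ 2 * dot (agrad h x) (agrad h x))
    + (1 - h x ^+ 2)^-1 * ((a * gap x) ^+ 2 * laplacian h x)
  - (2 * h y * ((b * gap y) ^+ 2 * dot (agrad h y) (agrad h y))
    + (1 - h y ^+ 2)^-1 * ((b * gap y) ^+ 2 * laplacian h y))
  - K * (sinh_half x y / (2 * cosh_half x y ^+ 3)
           * (4 * (a + b) ^+ 2 * (cosh_half x y / sinh_half x y) ^+ 2)
         + sinh_half x y / cosh_half x y * (\sum_(k < n) ddln_hratio x y (u k) (v k)))
  - e * (a ^+ 2 * (2 * n%:R * gap x + 4 * (1 - gap x))
         + b ^+ 2 * (2 * n%:R * gap y + 4 * (1 - gap y))) <= 0.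
  rewrite -Ex -Ey -Hx -Hy -Sx -Sy -T1.
  rewrite [X in X + _ - _ - _ - _ <= _]mulr_sumr.
  rewrite [X in _ + X - _ - _ - _ <= _]mulr_sumr.
  rewrite [X in _ - (X + _) - _ - _ <= _]mulr_sumr.
  rewrite [X in _ - (_ + X) - _ - _ <= _]mulr_sumr.
  rewrite [X in _ - K * (X + _) - _ <= _]mulr_sumr.
  rewrite [X in _ - K * (_ + X) - _ <= _]mulr_sumr.
  rewrite -!big_split/= [X in _ - X - _ <= _]mulr_sumr [X in _ - X <= _]mulr_sumr.
  rewrite -!sumrB; apply: sumr_le0 => k _.
  exact: (tpm (u k) (v k)).2.
rewrite T2 gx gy dotNl dotNr opprK in H.
set GX := dot (dist_grad K e x y) _ in H *; set GY := dot (dist_grad K e y x) _ in H *.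
rewrite gx in Lx; rewrite gy dotNr in Ly.
have NE : dot (x - y) (x - y) = sinh_half x y ^+ 2 * (gap x * gap y).
  by rewrite sE divfK// mulf_neq0// gt_eqF.
have xxE : dot x x = 1 - gap x by rewrite /gap opprB addrC subrK.
have yyE : dot y y = 1 - gap y by rewrite /gap opprB addrC subrK.
have xzE : dot x (x - y) = (dot (x - y) (x - y) + gap y - gap x) / 2.
  by rewrite /gap !dotE (dotC y x); field.
have yzE : dot y (y - x) = (dot (x - y) (x - y) + gap x - gap y) / 2.
  by rewrite /gap !dotE (dotC y x); field.
have nz : (sinh_half x y != 0) * (cosh_half x y != 0) * (gap x != 0) * (gap y != 0).
  by rewrite !gt_eqF.
rewrite xzE xxE NE in Dx; rewrite sC cC NC yzE yyE NE in Dy.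
have Wx : (1 - h x ^+ 2)^-1 * ((a * gap x) ^+ 2 * laplacian h x) =
    - (2 * (n%:R - 2) * a ^+ 2 * (gap x * dot x (dist_grad K e x y))).
  transitivity (a ^+ 2 * (gap x ^+ 2 * ((1 - h x ^+ 2)^-1 * laplacian h x))).
    by ring.
  by rewrite Lx; ring.
have Wy : (1 - h y ^+ 2)^-1 * ((b * gap y) ^+ 2 * laplacian h y) =
    2 * (n%:R - 2) * b ^+ 2 * (gap y * dot y (dist_grad K e y x)).
  transitivity (b ^+ 2 * (gap y ^+ 2 * ((1 - h y ^+ 2)^-1 * laplacian h y))).
    by ring.
  by rewrite Ly; ring.
rewrite Wx Wy Dx Dy NE in H.
have {H} Hf : 2 * h x * a ^+ 2 * (gap x ^+ 2 * GX)
    - 2 * h y * b ^+ 2 * (gap y ^+ 2 * GY)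
    - 4 * (n%:R - 1) * K * (((a ^+ 2 + b ^+ 2) * (1 + 2 * sinh_half x y ^+ 2)
                         - 2 * (a * b)) / (2 * sinh_half x y * cosh_half x y))
    - e * (a ^+ 2 * (4 * n%:R - 4 - (2 * n%:R - 4) * gap x)
           + b ^+ 2 * (4 * n%:R - 4 - (2 * n%:R - 4) * gap y)) <= 0.
  apply: le_trans H; rewrite le_eqVlt; apply/orP; left; apply/eqP.
  by field; rewrite !nz.
move=> By Bx.
have bound (w t B c0' : R) : -1 < w < 1 -> `|t - c0'| <= B -> 
  - B <= w * (t - c0') /\ w * (t - c0') <= B.
  move=> /andP[w1 w2] tB; apply/andP; rewrite -ler_norml normrM.
  rewrite (le_trans _ tB)// ler_piMl// ler_norml !ltW//.
have [Ax _] := bound _ _ _ _ (hr _ bx) Bx.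
have [_ Ay] := bound _ _ _ _ (hr _ byy) By.
have n4 : 0 <= 2 * n%:R - 4 :> R.
  by rewrite subr_ge0 (_ : 4 = 2 * 2%:R)// ?ler_pM2l// ?ler_nat//; ring.
have ga : 0 <= e * (a ^+ 2 * ((2 * n%:R - 4) * gap x + 4)).
  apply: (mulr_ge0 e0); apply: mulr_ge0; first exact: sqr_ge0.
  by apply: addr_ge0 => //; apply: (mulr_ge0 n4); exact: ltW.
have gb : 0 <= e * (b ^+ 2 * ((2 * n%:R - 4) * gap y + 4)).
  apply: (mulr_ge0 e0); apply: mulr_ge0; first exact: sqr_ge0.
  by apply: addr_ge0 => //; apply: (mulr_ge0 n4); exact: ltW.
have Aa := ler_wpM2l (sqr_ge0 a) Ax.
have Ab := ler_wpM2l (sqr_ge0 b) Ay.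
rewrite -subr_ge0 in Aa; rewrite -subr_ge0 in Ab; rewrite -oppr_ge0 in Hf.
rewrite -subr_ge0; set M := 4 * _ * _ * _ in Hf *.
have := addr_ge0 (addr_ge0 Hf (addr_ge0 ga gb))
  (mulr_ge0 (ler0n R 2) (addr_ge0 Aa Ab)).
by congr (0 <= _); ring.
Qed.

(** * The Lipschitz estimate *)

(** With [C = cosh d], [S = sinh d], [E = exp d] the choice [b = 1],
    [a = C + hy S] turns [a^2 (C - hx S) + b^2 (C + hy S) - 2 a b] into
    [- a S] times [C (hx - hy) - S (1 - hx hy)], and this last factor is positive
    as soon as [artanh hx - artanh hy > d]. The hypothesis on [M] says that the
    difference is at least [d + ln M / 2]; it also bounds [E] by
    [2 / (1 - lam)]. *)
Lemma two_point_gap {R : realType} (K r lam M hx hy s c : R) :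
  0 < s -> 0 < c -> c ^+ 2 = 1 + s ^+ 2 -> 0 < K -> 0 <= r -> lam < 1 ->
  `|hx| <= lam -> `|hy| <= lam -> 1 < M ->
  ((s + c) ^+ 2) ^+ 2 * M * ((1 - hx) * (1 + hy)) <= (1 + hx) * (1 - hy) ->
  (forall a b : R, 8 * K ^+ 2 * (a ^+ 2 * hx - b ^+ 2 * hy) <=
     8 * K ^+ 2 * (((a ^+ 2 + b ^+ 2) * (1 + 2 * s ^+ 2) - 2 * (a * b))
                   / (2 * s * c)) + r * (a ^+ 2 + b ^+ 2)) ->
  4 * K ^+ 2 * ((M - 1) * (1 - lam) ^+ 2) <=
  r * ((2 / (1 - lam)) ^+ 3 + 2 / (1 - lam)).
Proof.
move=> s0 c0 cE K0 r0 lam1; rewrite !ler_norml => /andP[x1 x2] /andP[y1 y2].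
move=> M1 EM ineq.
set E := (s + c) ^+ 2 in EM.
pose C := 1 + 2 * s ^+ 2; pose S := 2 * s * c.
have S0 : 0 < S by rewrite !mulr_gt0.
(* [E], [C] and [S] are [exp d], [cosh d] and [sinh d]. *)
have Ei : E^-1 = (c - s) ^+ 2.
  apply: (@mulfI _ E); first by rewrite expf_neq0// gt_eqF// addr_gt0.
  rewrite divff ?expf_neq0 ?gt_eqF ?addr_gt0// -exprMn.
  have -> : (s + c) * (c - s) = c ^+ 2 - s ^+ 2 by ring.
  by rewrite cE addrK expr1n.
have CE : C = (E + E^-1) / 2 by rewrite Ei /C /E; lra.
have SE : S = (E - E^-1) / 2 by rewrite Ei /S /E; lra.
have E1 : 1 < E.
  have := mulr_gt0 s0 c0; have := exprn_gt0 2 s0; rewrite /E; lra.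
have E0 : 0 < E by rewrite (lt_trans ltr01).
have C2 : C ^+ 2 = S ^+ 2 + 1 by rewrite CE SE; field; rewrite gt_eqF.
set B := C + hy * S.
set D := C * (hx - hy) - S * (1 - hx * hy).
have BD : 8 * K ^+ 2 * (B * D) <= r * (B ^+ 2 + 1).
  have := ineq B 1; rewrite expr1n !mulr1 mul1r -lerBlDl -/C -/S.
  apply: le_trans; rewrite le_eqVlt; apply/orP; left; apply/eqP.
  rewrite -mulrBr; congr (_ * _); apply: (@mulIf _ S); first by rewrite gt_eqF.
  rewrite [RHS]mulrBl divfK ?gt_eqF//.
  have BS : B * (C - S * hx) = 1 - S * D.
    rewrite (_ : B * (C - S * hx) = C ^+ 2 - C * S * (hx - hy) - hx * hy * S ^+ 2); last first.
      by rewrite /B; ring.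
    by rewrite C2 /D; ring.
  have -> : (B ^+ 2 * hx - hy) * S - ((B ^+ 2 + 1) * C - 2 * B) =
     - (B * (B * (C - S * hx))) + 2 * B - (C + hy * S) by ring.
  by rewrite BS -/B; ring.
have DE : 2 * E * D = (1 + hx) * (1 - hy) - E ^+ 2 * ((1 - hx) * (1 + hy)).
  by rewrite /D CE SE; field; rewrite gt_eqF.
have l0 : 0 < 1 - lam by rewrite subr_gt0.
have l2 : (1 - lam) ^+ 2 <= (1 - hx) * (1 + hy).
  by rewrite expr2; apply: ler_pM; rewrite ?(ltW l0)//; lra.
have M0 : 0 < M - 1 by rewrite subr_gt0.
have Dq : (M - 1) * (1 - lam) ^+ 2 <= 2 * D.
  rewrite -(ler_pM2l E0) [leRHS]mulrCA [leRHS]mulrA DE.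
  have H1 : E ^+ 2 * (M - 1) * ((1 - hx) * (1 + hy)) <=
      (1 + hx) * (1 - hy) - E ^+ 2 * ((1 - hx) * (1 + hy)) by lra.
  apply: le_trans H1; rewrite mulrA.
  have EE : E * (M - 1) <= E ^+ 2 * (M - 1).
    by rewrite ler_pM2r// -[leLHS]mulr1 [leRHS]expr2 ler_pM2l// ltW.
  apply: ler_pM => //; last exact: sqr_ge0.
  by apply: mulr_ge0; exact: ltW.
have EL : E <= 2 / (1 - lam).
  have H1 : E ^+ 2 * (1 - lam) ^+ 2 <= E ^+ 2 * M * ((1 - hx) * (1 + hy)).
    apply: ler_pM; rewrite ?sqr_ge0//.
    by rewrite ler_peMr ?sqr_ge0// ltW.
  have H2 : (E * (1 - lam)) ^+ 2 <= 2 ^+ 2.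
    rewrite exprMn (le_trans H1)// (le_trans EM)// [leRHS]expr2.
    by apply: ler_pM; lra.
  rewrite ler_pdivlMr//; move: H2; rewrite ler_sqr// nnegrE ?ler0n//.
  by apply: mulr_ge0; exact: ltW.
have Ei0 : 0 < E^-1 by rewrite invr_gt0.
have BE : E^-1 <= B <= E.
  have BE' : B = (E * (1 + hy) + E^-1 * (1 - hy)) / 2.
    by rewrite /B CE SE; field; rewrite gt_eqF.
  have EE : E^-1 <= E by rewrite (le_trans _ (ltW E1))// invf_le1 ?ltW.
  have H1 : 0 <= (E - E^-1) * (1 + hy) by apply: mulr_ge0; lra.
  have H2 : 0 <= (E - E^-1) * (1 - hy) by apply: mulr_ge0; lra.
  by rewrite BE'; apply/andP; split; lra.
case/andP: BE => B1 B2.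
have B0 : 0 < B by rewrite (lt_le_trans Ei0).
have q0 : 0 <= (M - 1) * (1 - lam) ^+ 2 by rewrite mulr_ge0 ?sqr_ge0 ?(ltW M0).
have H1 : 4 * K ^+ 2 * ((M - 1) * (1 - lam) ^+ 2) <= E * (8 * K ^+ 2 * (B * D)).
  have EB : 1 <= E * B by rewrite -(divff (lt0r_neq0 E0)) ler_pM2l.
  rewrite (_ : E * _ = 4 * K ^+ 2 * (E * B * (2 * D))); last by ring.
  rewrite ler_pM2l ?mulr_gt0 ?exprn_gt0// -[leLHS]mul1r.
  by apply: ler_pM.
apply: (le_trans H1); rewrite (le_trans (ler_wpM2l (ltW E0) BD))// mulrCA ler_wpM2l//.
rewrite mulrDr mulr1 -/(E ^+ 1); apply: lerD => //.
rewrite exprS; apply: ler_pM; rewrite ?sqr_ge0 ?(ltW E0)//.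
by rewrite ler_sqr ?nnegrE ?(le_trans B2) ?(ltW B0)// (le_trans (ltW E0)).
Qed.

Section Continuity.
Context {R : realType} {T : topologicalType}.
Implicit Types (f g : T -> R) (p : T).

Lemma continuous_ln_comp f p : {for p, continuous f} -> 0 < f p ->
  {for p, continuous (fun q => ln (f q))}.
Proof.
move=> cf f0; apply: (@continuous_comp _ _ _ f (@ln R)) => //.
exact: continuous_ln.
Qed.

Lemma continuous_sqrt_comp f p : {for p, continuous f} ->
  {for p, continuous (fun q => Num.sqrt (f q))}.
Proof.
move=> cf; apply: (@continuous_comp _ _ _ f (@Num.sqrt R)) => //.
exact: sqrt_continuous.
Qed.

Lemma continuous_artanh_comp f p : {for p, continuous f} -> -1 < f p < 1 ->
  {for p, continuous (fun q => artanh (f q))}.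
Proof.
move=> cf /andP[f1 f2].
have c1 : {for p, continuous (fun q => ln (1 + f q))}.
  apply: continuous_ln_comp; last by rewrite -ltrBlDl sub0r.
  apply: (@continuousD _ R^o _ (cst 1) f) => //; exact: cst_continuous.
have c2 : {for p, continuous (fun q => ln (1 - f q))}.
  apply: continuous_ln_comp; last by rewrite subr_gt0.
  apply: (@continuousB _ R^o _ (cst 1) f) => //; exact: cst_continuous.
apply: (@continuousM R T (fun q => ln (1 + f q) - ln (1 - f q)) (cst 2^-1)).
  exact: (@continuousB _ R^o).
exact: cst_continuous.
Qed.

Context {n : nat}.
Implicit Types x y : T -> 'rV[R]_n.

Lemma continuous_gap x p : {for p, continuous x} ->
  {for p, continuous (fun q => gap (x q))}.
Proof.
move=> cx; apply: (@continuousB _ R^o _ (cst 1) (fun q => dot (x q) (x q))).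
  exact: cst_continuous.
exact: dot_continuous.
Qed.

Lemma continuous_hdist x y p : {for p, continuous x} -> {for p, continuous y} ->
  unit_ball R n (x p) -> unit_ball R n (y p) ->
  {for p, continuous (fun q => hdist (x q) (y q))}.
Proof.
move=> cx cy bx byy.
move: (bx) (byy) => /unit_ballE Px /unit_ballE Py.
have cr : {for p, continuous (fun q => hratio (x q) (y q))}.
  apply: (@continuousM R T (fun q => dot (x q - y q) (x q - y q))
            (fun q => (gap (x q) * gap (y q))^-1)).
    apply: dot_continuous; exact: (@continuousB _ 'rV[R]_n _ x y).
  apply: (@continuousV _ _ (fun q => gap (x q) * gap (y q))).
    by rewrite gt_eqF// mulr_gt0.
  by apply: (@continuousM R T (fun q => gap (x q)) (fun q => gap (y q)));
    exact: continuous_gap.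
have r0 := hratio_ge0 bx byy.
apply: (@continuousM R T (cst 2)); first exact: cst_continuous.
apply: continuous_ln_comp; last first.
  by rewrite ltr_wpDl ?sqrtr_ge0// sqrtr_gt0 ltr_wpDr.
apply: (@continuousD _ R^o _ (fun q => sinh_half (x q) (y q))
  (fun q => cosh_half (x q) (y q))).
  exact: continuous_sqrt_comp.
apply: continuous_sqrt_comp.
by apply: (@continuousD _ R^o _ (cst 1)) => //; exact: cst_continuous.
Qed.

End Continuity.

Lemma two_point_continuous {R : realType} {n : nat} (h : 'rV[R]_n -> R)
    (K e : R) (x y : 'rV[R]_n) :
  (forall z, unit_ball R n z -> -1 < h z < 1) ->
  (forall z, unit_ball R n z -> {for z, continuous h}) ->
  unit_ball R n x -> unit_ball R n y ->
  {for (x, y), continuous (fun p => two_point h K e p.1 p.2)}.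
Proof.
move=> hr ch bx byy.
have c1 : {for (x, y), continuous (fst : 'rV[R]_n * 'rV[R]_n -> _)} by exact: cvg_fst.
have c2 : {for (x, y), continuous (snd : 'rV[R]_n * 'rV[R]_n -> _)} by exact: cvg_snd.
have h1 : {for (x, y), continuous (h \o fst)}.
  by apply: continuous_comp => //; exact: ch.
have h2 : {for (x, y), continuous (h \o snd)}.
  by apply: continuous_comp => //; exact: ch.
move: (bx) (byy) => /unit_ballE Px /unit_ballE Py.
have a1 := continuous_artanh_comp h1 (hr _ bx).
have a2 := continuous_artanh_comp h2 (hr _ byy).
have l1 := continuous_ln_comp (continuous_gap c1) Px.
have l2 := continuous_ln_comp (continuous_gap c2) Py.
have d := continuous_hdist c1 c2 bx byy.
have cst' (k : R) : {for (x, y), continuous (fun _ : 'rV[R]_n * 'rV[R]_n => k)}.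
  exact: cst_continuous.
apply: (@continuousD _ R^o).
  apply: (@continuousB _ R^o); first exact: (@continuousB _ R^o).
  exact: continuousM.
by apply: continuousM => //; exact: (@continuousD _ R^o).
Qed.

Lemma compact_gap {R : realType} {n : nat} (r : R) : 0 < r ->
  compact [set x : 'rV[R]_n | r <= gap x].
Proof.
move=> r0; apply: bounded_closed_compact.
  exists 1; split=> // M M1 x /= rx; apply: norm_le_coord.
    by rewrite ltW// (lt_trans _ M1).
  move=> i; apply: ltW; apply: le_lt_trans M1.
  have x1 : enorm x <= 1 by apply/ltW/unit_ballE; rewrite (lt_le_trans r0).
  rewrite -(dot_delta x i) (le_trans (cauchy_schwarz _ _))//.
  rewrite [X in _ * X]enormE dot_delta mxE !eqxx sqrtr1 mulr1//.
apply: (@closed_comp _ _ (@gap R n) [set t | r <= t]); last exact: closed_ge.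
by move=> x _; exact: continuous_gap.
Qed.

Lemma hdist_ge0 {R : realType} {n : nat} (x y : 'rV[R]_n) :
  unit_ball R n x -> unit_ball R n y -> 0 <= hdist x y.
Proof.
move=> bx byy; rewrite mulr_ge0// ln_ge0// -[leLHS]add0r lerD ?sqrtr_ge0//.
by rewrite -[leLHS]sqrtr1 ler_wsqrtr// lerDl hratio_ge0.
Qed.

Lemma hdistxx {R : realType} {n : nat} (x : 'rV[R]_n) : hdist x x = 0.
Proof.
have r0 : hratio x x = 0.
  by rewrite /hratio subrr -(scale0r (0 : 'rV[R]_n)) dotZl !mul0r.
by rewrite /hdist /sinh_half /cosh_half r0 addr0 sqrtr0 sqrtr1 add0r ln1 mulr0.
Qed.

Lemma ln_gap_le0 {R : realType} {n : nat} (x : 'rV[R]_n) :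
  unit_ball R n x -> ln (gap x) <= 0.
Proof. by move=> bx; rewrite ln_le0// gerBl dot_ge0. Qed.

(** Where [gap x < exp (- W / e)] the barrier outweighs the bound [W]; the
    remaining points form a compact set. *)
Lemma two_point_attains_max {R : realType} {n : nat} (h : 'rV[R]_n -> R)
    (K e W : R) : 0 <= K -> 0 < e ->
  (forall z, unit_ball R n z -> -1 < h z < 1) ->
  (forall z, unit_ball R n z -> {for z, continuous h}) ->
  (forall x y, unit_ball R n x -> unit_ball R n y ->
     artanh (h x) - artanh (h y) <= W) ->
  exists x y, [/\ unit_ball R n x, unit_ball R n y
    & forall x' y', unit_ball R n x' -> unit_ball R n y' ->
      two_point h K e x' y' <= two_point h K e x y].
Proof.
move=> K0 e0 hr ch hW.
have b0 : unit_ball R n 0.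
  by apply/unit_ballE; rewrite -(scale0r (0 : 'rV[R]_n)) dotZl !mul0r subr0.
have g0 : gap (0 : 'rV[R]_n) = 1.
  by rewrite /gap -(scale0r (0 : 'rV[R]_n)) dotZl !mul0r subr0.
have W0 : 0 <= W by have := hW _ _ b0 b0; rewrite subrr.
pose r := expR (- (W / e)).
have r0 : 0 < r by exact: expR_gt0.
pose A := [set x : 'rV[R]_n | r <= gap x].
have Ab x : A x -> unit_ball R n x.
  by move=> /= rx; apply/unit_ballE; exact: lt_le_trans r0 rx.
have A0 : A 0.
  by rewrite /A/= g0 -expR0 ler_expR oppr_le0 divr_ge0// ltW.
have f00 : two_point h K e 0 0 = 0.
  by rewrite /two_point hdistxx g0 ln1 !subrr addr0 !mulr0 subr0 addr0.
have [|||[x y]] := @compact_EVT_max _ R (fun p => two_point h K e p.1 p.2) (A `*` A).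
- by exists (0, 0).
- by apply: compact_setX; exact: compact_gap.
- apply: continuous_in_subspaceT => -[x y] /set_mem[/= Ax Ay].
  by apply: two_point_continuous; rewrite ?hr//; exact: Ab.
move=> /set_mem[/= Ax Ay] hmax; exists x, y; split; [exact: Ab|exact: Ab|].
move=> x' y' bx' by'.
have m0 : 0 <= two_point h K e x y by rewrite -f00; apply: (hmax (0, 0)); apply/mem_set.
have out (z w : 'rV[R]_n) : unit_ball R n z -> unit_ball R n w -> gap z < r ->
    e * (ln (gap z) + ln (gap w)) <= - W.
  move=> bz bw zr; rewrite -ler_pdivlMl// mulrC mulNr.
  have lz : ln (gap z) <= - (W / e).
    by rewrite -[leRHS]expRK ler_ln ?posrE ?(ltW zr)//; exact/unit_ballE.
  by rewrite -[leRHS]addr0 lerD// ln_gap_le0.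
have neg : e * (ln (gap x') + ln (gap y')) <= - W ->
    two_point h K e x' y' <= two_point h K e x y.
  move=> pen; apply: le_trans m0.
  have := hW _ _ bx' by'; have := mulr_ge0 K0 (hdist_ge0 bx' by').
  by rewrite /two_point; lra.
have [Ax'|Ax'] := leP r (gap x'); last by apply: neg; exact: out.
have [Ay'|Ay'] := leP r (gap y'); last by apply: neg; rewrite addrC; exact: out.
by apply: (hmax (x', y')); apply/mem_set.
Qed.

Lemma artanh_le {R : realType} (t u : R) : -1 < t -> u < 1 -> t <= u ->
  artanh t <= artanh u.
Proof.
move=> t1 u1 tu; rewrite /artanh ler_pM2r// lerB// ler_ln ?posrE//; lra.
Qed.

Lemma expR_artanh {R : realType} (t : R) : -1 < t < 1 ->
  expR (2 * artanh t) * (1 - t) = 1 + t.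
Proof.
move=> /andP[t1 t2].
have p0 : 0 < 1 + t by lra.
have m0 : 0 < 1 - t by lra.
rewrite /artanh [2 * _]mulrC divfK// expRD expRN !lnK ?posrE// -mulrA mulVf ?mulr1//.
by rewrite gt_eqF.
Qed.

Lemma expR_hdist {R : realType} {n : nat} (x y : 'rV[R]_n) :
  unit_ball R n x -> unit_ball R n y ->
  expR (hdist x y) = (sinh_half x y + cosh_half x y) ^+ 2.
Proof.
move=> bx byy; have r0 := hratio_ge0 bx byy.
rewrite /hdist expRM_natl lnK// posrE.
by rewrite ltr_wpDl ?sqrtr_ge0// sqrtr_gt0 ltr_wpDr.
Qed.

Lemma exists_small_pos {R : realType} (A a B b : R) : 0 <= A -> 0 < a -> 0 <= B -> 0 < b ->
  exists e : R, [/\ 0 < e, e <= 1, e * A < a & e * B < b].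
Proof.
move=> A0 a0 B0 b0; exists (Num.min 1 (Num.min (a / (A + 1)) (b / (B + 1)))).
have A1 : 0 < A + 1 by lra.
have B1 : 0 < B + 1 by lra.
have aA : 0 < a / (A + 1) by exact: divr_gt0.
have bB : 0 < b / (B + 1) by exact: divr_gt0.
set e := Num.min _ _.
have e0 : 0 < e by rewrite !lt_min ltr01 aA.
have ea : e <= a / (A + 1) by rewrite /e !ge_min lexx !orbT.
have eb : e <= b / (B + 1) by rewrite /e !ge_min lexx !orbT.
rewrite ler_pdivlMr// mulrDr mulr1 in ea; rewrite ler_pdivlMr// mulrDr mulr1 in eb.
by split; [|rewrite /e ge_min lexx|lra|lra].
Qed.

(** If the estimate failed, a small barrier would leave the maximum of the
    two-point function positive, hence attained off the diagonal, and
    [two_point_gap] would bound the excess by a multiple of the barrier. *)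
Lemma artanh_lipschitz {R : realType} {n : nat} (h : 'rV[R]_n -> R) (lam : R)
    (x1 y1 : 'rV[R]_n) : (3 <= n)%N -> lam < 1 ->
  (forall z, unit_ball R n z -> `|h z| <= lam) -> hyp_harmonic h ->
  unit_ball R n x1 -> unit_ball R n y1 ->
  artanh (h x1) - artanh (h y1) <= (n%:R - 1) / 2 * hdist x1 y1.
Proof.
move=> n3 lam1 hlam hh bx1 by1; rewrite leNgt; apply/negP => gap0.
pose K : R := (n%:R - 1) / 2.
have K1 : 1 <= K.
  by rewrite ler_pdivlMr// mul1r lerBrDr -[2 + 1]/(2%:R + 1%:R) -natrD ler_nat.
have K0 : 0 <= K by lra.
have hr z : unit_ball R n z -> -1 < h z < 1.
  by move=> /hlam; rewrite ler_norml => /andP[? ?]; lra.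
pose W := artanh lam - artanh (- lam).
have hW x y : unit_ball R n x -> unit_ball R n y -> artanh (h x) - artanh (h y) <= W.
  move=> bx byy; have /andP[hx1 hx2] := hr _ bx; have /andP[hy1 hy2] := hr _ byy.
  have := hlam _ bx; have := hlam _ byy; rewrite !ler_norml => /andP[? ?] /andP[? ?].
  by apply: lerB; apply: artanh_le => //; lra.
pose m := artanh (h x1) - artanh (h y1) - K * hdist x1 y1.
have m0 : 0 < m by rewrite subr_gt0.
pose L : R := (2 / (1 - lam)) ^+ 3 + 2 / (1 - lam).
pose c0 : R := (16 * K + 8 + 4 * n%:R) * L.
have l0 : 0 < 1 - lam by lra.
have L0 : 0 <= L by rewrite addr_ge0 ?exprn_ge0 ?divr_ge0 ?(ltW l0).
have n0 : 0 <= n%:R :> R by exact: ler0n.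
have c00 : 0 <= c0 by apply: mulr_ge0 => //; lra.
have M1 : 1 < expR m by rewrite -expR0 ltr_expR.
pose q := 4 * K ^+ 2 * ((expR m - 1) * (1 - lam) ^+ 2).
have q0 : 0 < q.
  apply: mulr_gt0; first by apply: mulr_gt0 => //; apply: exprn_gt0; lra.
  by apply: mulr_gt0; [rewrite subr_gt0|exact: exprn_gt0].
have p0 : 0 <= - (ln (gap x1) + ln (gap y1)).
  by rewrite oppr_ge0 -[leRHS]addr0 lerD// ln_gap_le0.
(* The barrier must cost less than half of the excess [m] at [(x1, y1)], and its
   error term [c0 * e] must stay below the bound [q] of [two_point_gap]. *)
have [e [e0 e1 ep ec]] := exists_small_pos p0 (divr_gt0 m0 (ltr0Sn R 1)) c00 q0.
have [x [y [bx byy hmax]]] :=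
  two_point_attains_max K0 e0 hr (fun z bz => (hh.1.1 z bz).1) hW.
have pos : m / 2 < two_point h K e x y.
  apply: lt_le_trans (hmax _ _ bx1 by1); rewrite /two_point -/m.
  by rewrite mulrN in ep; lra.
have pen z : unit_ball R n z -> e * ln (gap z) <= 0.
  by move=> bz; rewrite pmulr_rle0// ln_gap_le0.
have px := pen _ bx; have py := pen _ byy.
have xy : x != y.
  apply/eqP => xy; move: pos; rewrite /two_point xy hdistxx subrr mulr0.
  by rewrite -xy mulrDr; lra.
have [s0 c0' sE cE] := sinh_cosh_half bx byy xy.
have d0 := hdist_ge0 bx byy.
have far : hdist x y + m / 2 <= artanh (h x) - artanh (h y).
  have : hdist x y <= K * hdist x y by rewrite ler_peMl.
  by move: pos; rewrite /two_point mulrDr; lra.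
have n2 : (2 <= n)%N by exact: ltnW.
have ineq a b := two_point_inequality a b n2 hr hh bx byy xy K0 (ltW e0) hmax.
have [hx1 hx2] := andP (hr _ bx); have [hy1 hy2] := andP (hr _ byy).
have EM : ((sinh_half x y + cosh_half x y) ^+ 2) ^+ 2 * expR m * ((1 - h x) * (1 + h y))
    <= (1 + h x) * (1 - h y).
  rewrite -(expR_artanh (hr _ bx)) -(expR_artanh (hr _ byy)) -expR_hdist//.
  set ax := artanh (h x) in far *; set ay := artanh (h y) in far *.
  have -> : expR (hdist x y) ^+ 2 * expR m * ((1 - h x) * (expR (2 * ay) * (1 - h y)))
      = expR (2 * hdist x y + m + 2 * ay) * ((1 - h x) * (1 - h y)).
    rewrite (expRD (2 * hdist x y + m)) (expRD (2 * hdist x y)).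
    by rewrite (expRM_natl 2 (hdist x y)); ring.
  rewrite -[leRHS]mulrA; apply: ler_wpM2r; last by rewrite ler_expR; lra.
  by apply: mulr_ge0; lra.
have c1 : 0 <= 16 * K + 8 * e + 4 * n%:R by lra.
have : q <= e * (16 * K + 8 * e + 4 * n%:R) * L.
  apply: (two_point_gap s0 c0' cE _ _ lam1 (hlam _ bx) (hlam _ byy) M1 EM).
  - by lra.
  - exact: mulr_ge0 (ltW e0) c1.
  - move=> a b; have := ineq a b.
    by rewrite (_ : 4 * (n%:R - 1) * K = 8 * K ^+ 2)//; rewrite /K; field.
rewrite leNgt => /negP; apply; apply: le_lt_trans ec.
rewrite -mulrA; apply: (ler_wpM2l (ltW e0)); apply: (ler_wpM2r L0).
by lra.
Qed.

(** * The gradient estimate *)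

Lemma derive_le_right {R : realType} (f g : R -> R) (a : R) :
  is_derive (0 : R) 1 f a -> {for 0, continuous g} ->
  (\forall s \near 0^'+, f s - f 0 <= s * g s) -> a <= g 0.
Proof.
move=> [df <-] cg fg.
have dq : s^-1 * (f s - f 0) @[s --> 0^'+] --> 'D_1 f 0.
  apply: cvg_dnbhs_at_right; move: df; rewrite /derivable /derive /=.
  by under eq_fun do rewrite addr0 [_%:A]mulr1.
apply: (ler_cvg_to dq (cvg_at_right_filter cg)).
near=> s; have s0 : 0 < s by [].
rewrite ler_pdivrMl//; near: s; exact: fg.
Unshelve. all: by end_near. Qed.

Lemma hdist_le {R : realType} {n : nat} (x y : 'rV[R]_n) :
  unit_ball R n x -> unit_ball R n y ->
  hdist x y <= 2 * (sinh_half x y + sinh_half x y ^+ 2).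
Proof.
move=> bx byy; have r0 := hratio_ge0 bx byy.
have c0 : 0 <= cosh_half x y by exact: sqrtr_ge0.
have s0 : 0 <= sinh_half x y by exact: sqrtr_ge0.
have cE : cosh_half x y ^+ 2 = 1 + sinh_half x y ^+ 2.
  by rewrite !sqr_sqrtr// addr_ge0.
have c1 : cosh_half x y <= 1 + sinh_half x y ^+ 2.
  rewrite -ler_sqr ?nnegrE// ?addr_ge0 ?sqr_ge0// cE -[leLHS]mulr1 expr2.
  by rewrite ler_wpM2l// ?lerDl ?addr_ge0 ?sqr_ge0.
rewrite ler_pM2l//.
rewrite (_ : sinh_half x y + cosh_half x y = 1 + (sinh_half x y + cosh_half x y - 1));
  last by ring.
have c2 : 1 <= cosh_half x y by rewrite -[leLHS]sqrtr1 ler_wsqrtr// lerDl.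
apply: le_trans (le_ln1Dx _) _; lra.
Qed.

(** Difference quotients of the Lipschitz estimate, in the direction [v] of the
    gradient itself; the distance from [x] to [x + s v] is
    [2 s |v| / (1 - |x|^2)] to first order. *)
Lemma agrad_le {R : realType} {n : nat} (h : 'rV[R]_n -> R) (lam : R)
    (x : 'rV[R]_n) : (3 <= n)%N -> lam < 1 ->
  (forall z, unit_ball R n z -> `|h z| <= lam) -> hyp_harmonic h ->
  unit_ball R n x -> enorm (agrad h x) <= (n%:R - 1) / gap x.
Proof.
move=> n3 lam1 hlam hh bx.
have hr z : unit_ball R n z -> -1 < h z < 1.
  by move=> /hlam; rewrite ler_norml => /andP[? ?]; lra.
have Px : 0 < gap x by exact/unit_ballE.
pose K : R := (n%:R - 1) / 2.
have K0 : 0 <= K by rewrite divr_ge0// subr_ge0 ler1n (leq_trans _ n3).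
pose v := agrad h x.
pose G s := gap (x + s *: v) * gap x.
pose g s := K * (2 * (enorm v / Num.sqrt (G s) + s * (enorm v ^+ 2 / G s))).
have cG : {for 0, continuous G}.
  apply: (@continuousM R R (fun s => gap (x + s *: v)) (cst (gap x))).
    by apply: continuous_gap; exact: line_continuous.
  exact: cst_continuous.
have G0 : G 0 = gap x ^+ 2 by rewrite /G scale0r addr0 expr2.
have Gp : 0 < G 0 by rewrite G0 exprn_gt0.
have cst' (k : R) : {for 0, continuous (fun _ : R => k)} by exact: cst_continuous.
have cg : {for 0, continuous g}.
  apply: (@continuousM R R (cst K)); first exact: cst'.
  apply: (@continuousM R R (cst 2)); first exact: cst'.
  apply: (@continuousD _ R^o R).
    apply: (@continuousM R R (cst (enorm v))); first exact: cst'.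
    apply: (@continuousV R R (fun s => Num.sqrt (G s))).
      by rewrite gt_eqF// sqrtr_gt0.
    exact: continuous_sqrt_comp.
  apply: (@continuousM R R id); first exact: cvg_id.
  apply: (@continuousM R R (cst (enorm v ^+ 2))); first exact: cst'.
  by apply: (@continuousV R R G) => //; rewrite gt_eqF.
have le_g : dot v v <= g 0.
  apply: (derive_le_right (jet2_is_derive (jet2_artanh_line v hr hh.1 bx)) cg).
  near=> s.
  have s0 : 0 < s by [].
  have bs : unit_ball R n (x + s *: v).
    by near: s; exact: (cvg_within _ (near_line v open_unit_ball bx)).
  rewrite scale0r addr0.
  apply: le_trans (artanh_lipschitz n3 lam1 hlam hh bs bx) _.
  rewrite -/K /g [leRHS]mulrCA ler_wpM2l// (le_trans (hdist_le bs bx))//.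
  have Gs : 0 < G s by rewrite mulr_gt0//; exact/unit_ballE.
  have sE : sinh_half (x + s *: v) x = s * (enorm v / Num.sqrt (G s)).
    rewrite /sinh_half /hratio addrC addKr dotZl dotZr -/(G s) -enorm_sqr.
    have -> : s * (s * enorm v ^+ 2) = (s * enorm v) ^+ 2 by ring.
    rewrite sqrtrM ?sqr_ge0// sqrtr_sqr ger0_norm; last first.
      by rewrite mulr_ge0 ?enorm_ge0// ltW.
    by rewrite sqrtrV ?(ltW Gs)// mulrA.
  rewrite sE [leRHS]mulrCA ler_pM2l// mulrDr lerD// exprMn expr_div_n.
  by rewrite (sqr_sqrtr (ltW Gs)) [s ^+ 2]expr2 -mulrA.
have [v0|v0] := eqVneq v 0.
  rewrite -/v v0 enormE -(scale0r (0 : 'rV[R]_n)) dotZl mul0r sqrtr0.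
  by rewrite divr_ge0 ?(ltW Px)// subr_ge0 ler1n (leq_trans _ n3).
have ev : 0 < enorm v by rewrite enormE sqrtr_gt0 dot_gt0.
rewrite -(ler_pM2r ev) -/v -expr2 enorm_sqr (le_trans le_g)//.
rewrite /g mul0r addr0 G0 sqrtr_sqr gtr0_norm// /K le_eqVlt; apply/orP; left.
by apply/eqP; field; rewrite gt_eqF.
Unshelve. all: by end_near. Qed.

Lemma C1_on_eq {R : realType} {n : nat} (A : set 'rV[R]_n)
    (f g : 'rV[R]_n -> R) : open A -> (forall x, A x -> f x = g x) ->
  C1_on A f -> C1_on A g /\ forall i x, A x -> partial i g x = partial i f x.
Proof.
move=> oA fg Cf.
have near_fg x : A x -> \forall y \near x, f y = g y.
  by move=> Ax; apply: filterS (open_nbhs_nbhs (conj oA Ax)) => y; exact: fg.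
have pE i x : A x -> partial i g x = partial i f x.
  by move=> Ax; apply: near_eq_derive; apply: filterS (near_fg _ Ax).
split; last exact: pE.
move=> x Ax; have [cf df] := Cf x Ax; split.
  have : f y @[y --> x] --> f x by exact: cf.
  rewrite [f x]fg// => cfx.
  exact: cvg_trans (near_eq_cvg (near_fg _ Ax)) cfx.
move=> i; have [dfi cfi] := df i; split.
  exact: near_eq_derivable (near_fg _ Ax) dfi.
have : partial i f y @[y --> x] --> partial i f x by exact: cfi.
rewrite -(pE _ _ Ax) => cfx.
have np : \forall y \near x, partial i f y = partial i g y.
  by apply: filterS (open_nbhs_nbhs (conj oA Ax)) => y Ay; rewrite pE.
exact: cvg_trans (near_eq_cvg np) cfx.
Qed.

Lemma C1_onZ {R : realType} {n : nat} (A : set 'rV[R]_n)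
    (f : 'rV[R]_n -> R) (k : R) : open A -> C1_on A f ->
  C1_on A (fun x => k * f x) /\
  forall i x, A x -> partial i (fun x => k * f x) x = k * partial i f x.
Proof.
move=> oA Cf.
have pE i x : A x -> partial i (fun x => k * f x) x = k * partial i f x.
  by move=> Ax; have [_ /(_ i)[dfi _]] := Cf x Ax; exact: (deriveZ k dfi).
split; last exact: pE.
move=> x Ax; have [cf df] := Cf x Ax; split.
  by apply: (@continuousM R _ (cst k) f) => //; exact: cst_continuous.
move=> i; have [dfi cfi] := df i; split; first exact: (@derivableZ R _ _ f k x _ dfi).
have : k * partial i f y @[y --> x] --> k * partial i f x.
  by apply: (@continuousM R _ (cst k)) => //; exact: cst_continuous.
rewrite -(pE i x Ax) => cfx.
have np : \forall y \near x, k * partial i f y = partial i (fun z => k * f z) y.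
  by apply: filterS (open_nbhs_nbhs (conj oA Ax)) => y Ay; rewrite pE.
exact: cvg_trans (near_eq_cvg np) cfx.
Qed.

Lemma hyp_harmonicZ {R : realType} {n : nat} (h : 'rV[R]_n -> R) (k : R) :
  hyp_harmonic h -> hyp_harmonic (fun x => k * h x).
Proof.
move=> [[C1h C2h] hh].
have [C1k pk] := C1_onZ k open_unit_ball C1h.
have C2k i := C1_onZ k open_unit_ball (C2h i).
have C2k' i : C1_on (unit_ball R n) (partial i (fun x => k * h x)) /\
    forall j x, unit_ball R n x -> partial j (partial i (fun x => k * h x)) x
       = k * partial j (partial i h) x.
  have [H1 H2] := C1_on_eq open_unit_ball (fun x bx => esym (pk i x bx)) (C2k i).1.
  by split=> // j x bx; rewrite H2// (C2k i).2.
split; first by split; [exact: C1k|move=> i; exact: (C2k' i).1].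
move=> x bx; rewrite -[RHS](mulr0 k) -(hh _ bx) /hyp_laplacian.
have lapE : laplacian (fun x => k * h x) x = k * laplacian h x.
  by rewrite /laplacian mulr_sumr; apply: eq_bigr => i _; exact: (C2k' i).2 i x bx.
have drE : \sum_(i < n) x ord0 i * partial i (fun x => k * h x) x =
    k * \sum_(i < n) x ord0 i * partial i h x.
  by rewrite mulr_sumr; apply: eq_bigr => i _; rewrite (pk i x bx); ring.
by rewrite lapE drE; ring.
Qed.

(** [agrad_le] applies to [k * h] with [k < 1], and the bound is continuous at
    [k = 1]. *)
Lemma gradient_estimate {R : realType} {n : nat} (h : 'rV[R]_n -> R)
    (x : 'rV[R]_n) : (3 <= n)%N ->
  (forall z, unit_ball R n z -> -1 < h z < 1) -> hyp_harmonic h ->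
  unit_ball R n x ->
  enorm (gradient h x) <= (n%:R - 1) * ((1 - h x ^+ 2) / gap x).
Proof.
move=> n3 hr hh bx.
have Px : 0 < gap x by exact/unit_ballE.
have n1 : 0 < n%:R - 1 :> R by rewrite subr_gt0 ltr1n (leq_trans _ n3).
have /andP[hx1 hx2] := hr _ bx.
have scaled (k : R) : 0 < k < 1 ->
    k * enorm (gradient h x) <= (n%:R - 1) * ((1 - k ^+ 2 * h x ^+ 2) / gap x).
  move=> /andP[k0 k1].
  have hk z : unit_ball R n z -> `|k * h z| <= k.
    move=> bz; have /andP[? ?] := hr _ bz.
    by rewrite normrM gtr0_norm// ler_piMr ?(ltW k0)// ler_norml; lra.
  have := agrad_le n3 k1 hk (hyp_harmonicZ k hh) bx.
  have d0 : 0 < 1 - (k * h x) ^+ 2.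
    have : `|k * h x| < 1 by exact: le_lt_trans (hk _ bx) k1.
    by rewrite subr_gt0 -(real_normK (num_real (k * h x))) => ?; rewrite expr_lt1.
  have enormZ (c : R) (v : 'rV[R]_n) : 0 <= c -> enorm (c *: v) = c * enorm v.
    move=> c0; rewrite !enormE dotZl dotZr mulrA -expr2 sqrtrM ?sqr_ge0//.
    by rewrite sqrtr_sqr ger0_norm.
  have -> : agrad (fun x => k * h x) x = (k / (1 - (k * h x) ^+ 2)) *: gradient h x.
    apply/rowP => i; rewrite !mxE.
    by rewrite (C1_onZ k open_unit_ball hh.1.1).2//; ring.
  rewrite enormZ ?divr_ge0 ?(ltW k0) ?(ltW d0)// mulrAC ler_pdivrMr// exprMn.
  by rewrite [leRHS]mulrAC -[leRHS]mulrA.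
have c0 : 0 <= (n%:R - 1) / gap x by rewrite divr_ge0 ?ltW.
set c := (n%:R - 1) / gap x in c0.
set g := enorm (gradient h x) in scaled *.
have g0 : 0 <= g by exact: enorm_ge0.
have cE t : (n%:R - 1) * (t / gap x) = c * t by rewrite mulrC mulrAC -mulrA mulrC.
rewrite cE; apply/ler_addgt0Pr => e e0.
have [d [d0 d1 dA dh]] : exists d : R, [/\ 0 < d, d <= 1, d * (2 * c + g) < e & d * 2 < 1].
  by apply: exists_small_pos => //; rewrite addr_ge0// mulr_ge0.
have d01 : 0 < 1 - d < 1 by apply/andP; split; lra.
have := scaled _ d01; rewrite cE => H.
have h1 : h x ^+ 2 <= 1 
  by rewrite -(real_normK (num_real (h x))) expr_le1// ler_norml !ltW.
have d2 : 0 <= 2 * d - d ^+ 2.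
  by rewrite (_ : _ - _ = d * (2 - d)); [apply: mulr_ge0; lra|ring].
have : c * (h x ^+ 2 * (2 * d - d ^+ 2)) <= c * (2 * d).
  apply: (ler_wpM2l c0); apply: (le_trans (ler_wpM2r d2 h1)).
  by rewrite mul1r gerBl sqr_ge0.
by lra.
Qed.

(** * Lengths of piecewise continuously differentiable curves *)

Lemma partition_cover {R : realType} (a b t : R) (s : seq R) :
  itv_partition a b s -> a <= t <= b ->
  t \in a :: s \/
  exists2 i, (i < size s)%N & nth b (a :: s) i < t < nth b s i.
Proof.
move=> [+ /eqP]; elim: s a => [|c s IH] a /=.
  by move=> _ -> tb; left; rewrite inE eq_le andbC.
move=> /andP[ac cs] cb /andP[at' tb].
have [->|ta] := eqVneq t a; first by left; rewrite inE eqxx.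
have [tc|ct] := ltP t c.
  by right; exists 0%N => //=; rewrite tc lt_def ta at'.
have [|ts|[i si H]] := IH c cs cb; first by rewrite ct.
  by left; rewrite inE ts orbT.
by right; exists i.+1.
Qed.

Lemma partition_node {R : realType} (a b t : R) (s : seq R) (i : nat) :
  itv_partition a b s -> (i < size s)%N ->
  t \in `[nth b (a :: s) i, nth b s i] -> t \in `[a, b].
Proof.
move=> abs si; rewrite !in_itv/= => /andP[t1 t2]; apply/andP; split.
  by apply: le_trans t1; apply: (itv_partition_nth_ge _ abs); exact: ltnW.
by apply: (le_trans t2); exact: (@itv_partition_nth_le _ _ a b s i.+1).
Qed.

(** [U] is the complement in [[a, b]] of the nodes of the subdivision. *)
Lemma piecewise_C1_smooth {R : realType} {n : nat} (a b : R)
    (g : R -> 'rV[R]_n) : piecewise_C1 a b g ->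
  exists U : set R, [/\ open U, U `<=` `[a, b], countable (`[a, b] `\` U)
    & forall t, U t -> derivable g t 1 /\ {for t, continuous (derive1 g)}].
Proof.
move=> [s abs gs].
pose I i : set R := `]nth b (a :: s) i, nth b s i[%classic.
pose U := \bigcup_(i in [set i | (i < size s)%N]) I i.
exists U; split.
- by apply: bigcup_open => i _; exact: interval_open.
- move=> t [i /= si]; rewrite /I/= => ti; apply: (partition_node abs si).
  exact: subset_itv_oo_cc ti.
- apply: finite_set_countable; apply: sub_finite_set (finite_seq (a :: s)).
  move=> t [/=]; rewrite in_itv/= => tab nU.
  have [//|[i si ti]] := partition_cover abs tab.
  by exfalso; apply: nU; exists i => //; rewrite /I/= in_itv.
- move=> t [i /= si It]; have [_ [dg [cdg gdg]]] := gs i si.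
  have dgE u : I i u -> derive1 g u = dg u.
    by move=> /gdg [_ dgu]; rewrite derive1E.
  split; first by have [] := gdg t It.
  have cI : {within I i, continuous dg}.
    by apply: continuous_subspaceW cdg; exact: subset_itv_oo_cc.
  rewrite continuous_open_subspace in cI; last exact: interval_open.
  have : dg u @[u --> t] --> dg t by apply: cI; exact/mem_set.
  rewrite -(dgE _ It) => cu.
  have nI : \forall u \near t, dg u = derive1 g u.
    have oI : open (I i) by exact: interval_open.
    by apply: filterS (open_nbhs_nbhs (conj oI It)) => u /dgE ->.
  exact: cvg_trans (near_eq_cvg nI) cu.
Qed.

(** The integrand of [hyp_length]. *)
Definition hyp_speed {R : realType} {n : nat} (g : R -> 'rV[R]_n) (t : R) : R :=
  2 * enorm (derive1 g t) / (1 - enorm (g t) ^+ 2).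

Lemma hyp_speed_ge0 {R : realType} {n : nat} (g : R -> 'rV[R]_n) (t : R) :
  unit_ball R n (g t) -> 0 <= hyp_speed g t.
Proof.
move=> /unit_ballE gt; rewrite divr_ge0// ?mulr_ge0 ?enorm_ge0//.
by rewrite enorm_sqr ltW.
Qed.

Lemma countable_measurable_fun {R : realType} (N : set R) (f : R -> R) :
  countable N -> measurable_fun N f.
Proof.
move=> cN _ B _; apply: countable_measurable => //.
apply: sub_countable cN; apply: subset_card_le; exact: subIsetl.
Qed.

(** The hyperbolic hyp_speed is continuous away from a countable set. *)
Lemma measurable_hyp_speed {R : realType} {n : nat} (x y : 'rV[R]_n)
    (g : R -> 'rV[R]_n) : curve_in_ball x y g ->
  measurable_fun (`[0, 1] : set R) (hyp_speed g).
Proof.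
move=> [/piecewise_C1_smooth[U [oU U01 cN gU]] _ _ gb].
rewrite -(setDUK U01).
apply/measurable_funU.
- exact: open_measurable.
- by apply: countable_measurable.
split; last exact: countable_measurable_fun.
apply: open_continuous_measurable_fun => // t /set_mem Ut.
have [gt dgt] := gU t Ut.
have dft : differentiable g t := (derivable1_diffP g t).1 gt.
have cgt : {for t, continuous g} := differentiable_continuous dft.
have /unit_ballE bt := gb _ (U01 _ Ut).
apply: (@continuousM R R (fun t => 2 * enorm (derive1 g t))
    (fun t => (1 - enorm (g t) ^+ 2)^-1)).
  apply: (@continuousM R R (cst 2)); first exact: cst_continuous.
  have -> : (fun t => enorm (derive1 g t)) =
      (fun t => Num.sqrt (dot (derive1 g t) (derive1 g t))).
    by apply/funext => u; rewrite enormE.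
  by apply: continuous_sqrt_comp; exact: dot_continuous.
apply: (@continuousV R R (fun t => 1 - enorm (g t) ^+ 2)).
  by rewrite enorm_sqr gt_eqF.
have -> : (fun t => 1 - enorm (g t) ^+ 2) = (fun t => gap (g t)).
  by apply/funext => u; rewrite enorm_sqr.
exact: continuous_gap.
Qed.

Lemma dot_real_diameter {R : realType} (t : R) :
  dot (real_diameter t) (real_diameter t) = t ^+ 2.
Proof. by rewrite /real_diameter dotZl dotZr dot_delta mxE !eqxx mulr1 expr2. Qed.

Lemma real_diameter_ball {R : realType} (t : R) :
  -1 < t < 1 -> unit_ball R 2 (real_diameter t).
Proof.
move=> /andP[t1 t2]; apply/unit_ballE; rewrite dot_real_diameter.
by rewrite (_ : 1 - t ^+ 2 = (1 - t) * (1 + t)); [apply: mulr_gt0; lra|ring].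
Qed.

Lemma continuous_real_diameter {R : realType} : continuous (@real_diameter R).
Proof. by move=> t; exact: scalel_continuous. Qed.

Lemma is_derive_real_diameter {R : realType} (f : R -> R) (t d : R) :
  is_derive t 1 f d ->
  is_derive t 1 (fun s => real_diameter (f s)) (real_diameter d).
Proof.
move=> [/derivable1_diffP ft fE].
have [rt rE] : is_diff (f t) (@real_diameter R) (@real_diameter R).
  exact: is_diff_scalel.
have cd : differentiable (@real_diameter R \o f) t by exact: differentiable_comp.
split; first exact: ((derivable1_diffP (@real_diameter R \o f) t).2 cd).
have -> : (fun s => real_diameter (f s)) = @real_diameter R \o f by [].
by rewrite deriveE// diff_comp//= rE -fE deriveE.
Qed.

Lemma within_continuous_comp {R : realType} {n : nat} (A : set R)
    (B : set 'rV[R]_n) (T : topologicalType) (f : 'rV[R]_n -> T)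
    (g : R -> 'rV[R]_n) : (forall x, B x -> {for x, continuous f}) ->
  (forall t, A t -> B (g t)) -> {within A, continuous g} ->
  {within A, continuous (f \o g)}.
Proof.
move=> cf AB /subspace_continuousP cg; apply/subspace_continuousP => t At.
exact: (cvg_comp _ _ (cg t At) (cf _ (AB _ At))).
Qed.

Lemma C1_segment_image {R : realType} {n : nat} (h : 'rV[R]_n -> R) (a b : R)
    (g : R -> 'rV[R]_n) : C1_on (unit_ball R n) h ->
  (forall t, t \in `[a, b] -> unit_ball R n (g t)) ->
  C1_segment a b g -> C1_segment a b (fun t => real_diameter (h (g t))).
Proof.
move=> Ch gb [cg [dg [cdg gdg]]].
have gb' t : [set` `[a, b]] t -> unit_ball R n (g t) by exact: gb.
have ch x : unit_ball R n x -> {for x, continuous h} by move=> /Ch[].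
have cr := @continuous_real_diameter R.
split.
  have crh x : unit_ball R n x -> {for x, continuous (@real_diameter R \o h)}.
    by move=> bx; apply: continuous_comp; [exact: ch|exact: cr].
  exact: (within_continuous_comp crh gb' cg).
exists (fun t => real_diameter (\sum_(i < n) dg t ord0 i * partial i h (g t))).
split; last first.
  move=> t tab; apply: is_derive_real_diameter.
  have tcc : t \in `[a, b] by exact: subset_itv_oo_cc tab.
  exact: (C1_is_derive_comp open_unit_ball Ch (gb _ tcc) (gdg t tab)).
have cp i x : unit_ball R n x -> {for x, continuous (partial i h)}.
  by move=> /Ch[_ /(_ i)[]].
have cs : {within `[a, b], continuous (fun t => \sum_(i < n) dg t ord0 i * partial i h (g t))}.
  move=> t; apply: (@sum_continuous R n (subspace `[a, b])
    (fun i t => dg t ord0 i * partial i h (g t))) => i.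
  apply: (@continuousM R (subspace `[a, b]) (fun t => dg t ord0 i)
            (fun t => partial i h (g t))).
    by apply: (@coord_comp_continuous R n (subspace `[a, b]) dg); exact: cdg.
  exact: (within_continuous_comp (cp i) gb' cg).
by move=> t; exact: (continuous_comp (cs t) (cr _)).
Qed.

Lemma curve_image {R : realType} {n : nat} (h : 'rV[R]_n -> R)
    (x y : 'rV[R]_n) (g : R -> 'rV[R]_n) : C1_on (unit_ball R n) h ->
  (forall z, unit_ball R n z -> -1 < h z < 1) -> curve_in_ball x y g ->
  curve_in_ball (real_diameter (h x)) (real_diameter (h y))
    (fun t => real_diameter (h (g t))).
Proof.
move=> Ch hr [[s s01 gs] g0 g1 gb]; split; [|by rewrite g0|by rewrite g1|].
  exists s => // i si; apply: C1_segment_image (gs i si) => // t ti.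
  exact: gb (partition_node s01 si ti).
by move=> t /gb/hr/real_diameter_ball.
Qed.

(** The chain rule, Cauchy-Schwarz and [gradient_estimate]. *)
Lemma hyp_speed_image_le {R : realType} {n : nat} (h : 'rV[R]_n -> R)
    (g : R -> 'rV[R]_n) (t : R) : (3 <= n)%N ->
  (forall z, unit_ball R n z -> -1 < h z < 1) -> hyp_harmonic h ->
  unit_ball R n (g t) -> derivable g t 1 ->
  hyp_speed (fun t => real_diameter (h (g t))) t <= (n%:R - 1) * hyp_speed g t.
Proof.
move=> n3 hr hh gb dg.
have dh := C1_is_derive_comp open_unit_ball hh.1.1 gb (derivableP dg).
have := is_derive_real_diameter dh => -[_ dr].
have P0 : 0 < gap (g t) by exact/unit_ballE.
have /andP[h1 h2] := hr _ gb.
have H0 : 0 < 1 - h (g t) ^+ 2.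
  by rewrite (_ : 1 - _ = (1 - h (g t)) * (1 + h (g t))); [apply: mulr_gt0; lra|ring].
rewrite /hyp_speed derive1E dr enorm_sqr dot_real_diameter enormE dot_real_diameter sqrtr_sqr.
rewrite derive1E enorm_sqr -/(gap (g t)).
set v := 'D_1 g t.
have -> : \sum_(i < n) v ord0 i * partial i h (g t) = dot v (gradient h (g t)).
  by apply: eq_bigr => i _; rewrite mxE.
rewrite ler_pdivrMr// (le_trans (ler_wpM2l _ (cauchy_schwarz _ _)))//.
have := ler_wpM2l (enorm_ge0 v) (gradient_estimate n3 hr hh gb) => H.
rewrite (le_trans (ler_wpM2l _ H))// le_eqVlt; apply/orP; left; apply/eqP.
by field; rewrite gt_eqF.
Qed.

Lemma hyp_length_image_le {R : realType} {n : nat} (h : 'rV[R]_n -> R)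
    (x y : 'rV[R]_n) (g : R -> 'rV[R]_n) : (3 <= n)%N ->
  (forall z, unit_ball R n z -> -1 < h z < 1) -> hyp_harmonic h ->
  curve_in_ball x y g ->
  (hyp_length (fun t => real_diameter (h (g t)))
    <= (n%:R - 1)%:E * hyp_length g)%E.
Proof.
move=> n3 hr hh cg.
have cG := curve_image hh.1.1 hr cg.
have n1 : 0 <= n%:R - 1 :> R by rewrite subr_ge0 ler1n (leq_trans _ n3).
have mg := measurable_hyp_speed cg; have mG := measurable_hyp_speed cG.
have [pg _ _ gb] := cg.
have [U [_ U01 cN gU]] := piecewise_C1_smooth pg.
have sg t : [set` `[0%R, 1%R]] t -> 0 <= hyp_speed g t by move=> /gb; exact: hyp_speed_ge0.
have sG t : [set` `[0%R, 1%R]] t -> 0 <= hyp_speed (fun t => real_diameter (h (g t))) t.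
  move=> t01; apply: (@hyp_speed_ge0 R 2 (fun t => real_diameter (h (g t))) t).
  exact: real_diameter_ball (hr _ (gb t t01)).
have m01 : measurable (`[0%R, 1%R] : set R) by exact: measurable_itv.
have mgE : measurable_fun (`[0%R, 1%R] : set R) (EFin \o hyp_speed g).
  exact/measurable_EFinP.
have mGE : measurable_fun (`[0%R, 1%R] : set R)
    (EFin \o hyp_speed (fun t => real_diameter (h (g t)))).
  exact/measurable_EFinP.
have mkE : measurable_fun (`[0%R, 1%R] : set R)
    (fun t => ((n%:R - 1)%:E * (hyp_speed g t)%:E)%E).
  by apply: (measurable_funeM (n%:R - 1)%:E mgE).
have sgE t : [set` `[0%R, 1%R]] t -> (0 <= (hyp_speed g t)%:E)%E.
  by move=> /sg; rewrite lee_fin.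
have lenE := ge0_integralZl_EFin (@lebesgue_measure R) m01 sgE mgE n1.
suff le : (\int[@lebesgue_measure R]_(t in `[0%R, 1%R])
    (EFin \o hyp_speed (fun t => real_diameter (h (g t)))) t <=
  \int[@lebesgue_measure R]_(t in `[0%R, 1%R])
    ((n%:R - 1)%:E * (hyp_speed g t)%:E))%E by rewrite lenE in le.
have L := @ae_ge0_le_integral _ _ _ (@lebesgue_measure R) _ m01 _ _ _ mGE _ mkE.
apply: L.
- by move=> t /sG; rewrite lee_fin.
- by move=> t /sg s0; rewrite -EFinM lee_fin; exact: mulr_ge0.
exists (`[0%R, 1%R] `\` U); split.
- by apply: countable_measurable.
- exact: countable_lebesgue_measure0.
move=> t /= nt; apply: contrapT => tU; apply: nt => t01.
have Ut : U t by apply: contrapT => nUt; exact: tU.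
rewrite -EFinM lee_fin; apply: hyp_speed_image_le => //; first exact: gb.
exact: (gU t Ut).1.
Qed.

Lemma hyp_dist_image_le {R : realType} {n : nat} (h : 'rV[R]_n -> R)
    (x y : 'rV[R]_n) : (3 <= n)%N ->
  (forall z, unit_ball R n z -> -1 < h z < 1) -> hyp_harmonic h ->
  (hyp_dist (real_diameter (h x)) (real_diameter (h y))
    <= (n%:R - 1)%:E * hyp_dist x y)%E.
Proof.
move=> n3 hr hh.
have n1 : 0 < n%:R - 1 :> R by rewrite subr_gt0 ltr1n (leq_trans _ n3).
rewrite /hyp_dist -ereal_inf_pZl//; apply: le_ereal_inf_tmp => _ [_ [g cg <-] <-].
apply: le_trans (hyp_length_image_le n3 hr hh cg).
by apply: ereal_inf_lbound; exists (fun t => real_diameter (h (g t))) => //;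
  exact: curve_image hh.1.1 hr cg.
Qed.

Theorem theorem2p6 (R : realType) (n : nat) (hn : (3 <= n)%N)
  (h : 'rV[R]_n -> R)
  (h_range : forall x, unit_ball R n x -> -1 < h x < 1)
  (h_harm : hyp_harmonic h) :
  (forall x, unit_ball R n x ->
     enorm (gradient h x)
       <= (n%:R - 1) * ((1 - `|h x| ^+ 2) / (1 - enorm x ^+ 2)))
  /\
  (forall x1 x2, unit_ball R n x1 -> unit_ball R n x2 ->
     (hyp_dist (real_diameter (h x1)) (real_diameter (h x2))
       <= (n%:R - 1)%:E * hyp_dist x1 x2)%E).
Proof.
split=> [x bx|x1 x2 _ _]; last exact: hyp_dist_image_le.
rewrite enorm_sqr real_normK ?num_real//.
exact: gradient_estimate.
Qed.
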